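(* For each $h\in\{2,3,4\}$ there is an infinite $B_h$ sequence $\mathcal{B}$ of positive integers whose counting function satisfies $$\mathcal{B}(x)=x^{\sqrt{(h-1)^2+1}-(h-1)+o(1)}\qquad (x\to\infty).$$
   Context: For an integer $h\ge 2$, a sequence (set) $\mathcal{B}$ of positive integers is a $B_h$ sequence if all the sums $b_1+\cdots+b_h$ with $b_1,\dots,b_h\in\mathcal{B}$ and $b_1\le b_2\le\cdots\le b_h$ are distinct. The counting function of $\mathcal{B}$ is $\mathcal{B}(x)=|\mathcal{B}\cap[1,x]|$. *)

(* Defs.v *)
From HB Require Import structures.
From mathcomp Require Import all_boot all_order all_algebra.
From mathcomp Require Import finmap.
From mathcomp Require Import all_classical all_reals all_analysis.

Set Implicit Arguments.
Unset Strict Implicit.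
Unset Printing Implicit Defensive.

Import Order.TTheory GRing.Theory Num.Theory.
Import numFieldNormedType.Exports.

Local Open Scope classical_set_scope.
Local Open Scope ring_scope.

(* The sums b_1 + ... + b_h are indexed by the nondecreasing h-tuples of
   elements of B; "the sums are all distinct" is injectivity of the sum on
   these tuples. *)
Definition Bh_sequence (h : nat) (B : set nat) : Prop :=
  (forall b, B b -> (0 < b)%N) /\
  set_inj [set b : h.-tuple nat | sorted leq b /\ forall i, B (tnth b i)]
          (fun b => (\sum_(i < h) tnth b i)%N).

Definition counting_function (R : realType) (B : set nat) (x : R) : nat :=
  #|` fset_set (B `&` [set n : nat | (1 : R) <= n%:R <= x])|%fset.

(* f(x) = x^(c + o(1)) as x -> +oo, the o(1) being a real function e. *)
Definition eq_powR_o1 (R : realType) (f : R -> R) (c : R) : Prop :=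
  exists e : R -> R,
    e x @[x --> +oo] --> (0 : R) /\
    \forall x \near +oo, f x = x `^ (c + e x).

(* Main.v *)
Require Import Defs.
From mathcomp Require Import all_boot all_order all_fingroup all_algebra all_solvable.
From mathcomp Require Import finmap zify ring lra.
From mathcomp Require Import all_classical all_reals all_analysis.

Set Implicit Arguments.
Unset Strict Implicit.
Unset Printing Implicit Defensive.

Import Order.TTheory GRing.Theory Num.Theory.
Import numFieldNormedType.Exports.

(** The construction follows Ruzsa's idea of turning multiplicative independence
of primes into additive independence.  Let [c] be the exponent; it is the
positive root of [c^2 + 2 (h - 1) c = 1].

Fix primes [q_0, q_1, ...] with [q_i] of size about [2^(2i+1)], so that
[q_0 ... q_(k-1)] is about [2^(k^2)].  Sort other primes into levels: level [n]
has about [2^(c n^2)] primes, all at most [2^(c n^2)].  A prime [p] of level [n]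
is sent to the integer whose [i]-th digit, in a mixed radix proportional to the
[q_i] and for [i] up to about [n], encodes the discrete logarithm of [p] modulo
[q_i].  This integer is [2^(n^2 (1 + o(1)))], so the image has counting function
[x^(c + o(1))].  If two sums of [h] such integers are equal, no carries occur and
the digits agree: both sums have the same levels, and for every [i] the product
of the primes which have an [i]-th digit is the same modulo [q_i] on both sides.

After cancelling the common primes, let [n] be the highest level that occurs,
[m] the lowest one, and [2^S] the bound that the levels give for either product
of primes.  The two full products differ and are congruent modulo
[q_0 ... q_(m-1)], hence [m^2 <= S] up to lower order terms.  As [m] is the level
of one prime and the other [h - 1] have level at most [n], this gives
[(1 - c) S <= (h - 1) c n^2], and by the equation for [c]
[2 S <= (1 + c) n^2] (energy_le).  So at most [2^((1 + c) n^2)] pairs of products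
can collide (count_light).

Each such pair collides only when [q_i] divides a fixed nonzero number for all
[i] below [n]; if every [q_i] is drawn among about [2^(2i+1)] primes, this has
probability about [2^(- n^2)] (count_collide).  On average, then, the collisions
spoil no more than about [2^(c n^2)] primes of level [n].  The true count is
beaten below the size of the level by giving level [n] a few more digits than
[n]: the surplus of order [log n] wins a factor [2^(n log n)] over all losses.
Hence for each bound on the levels some choice of the [q_i] spoils at most half
of each level, and by compactness one infinite choice does so for all levels
(good_moduli).  The primes that are not spoiled give the sequence.
Chebyshev's lower bound for the number of primes (nth_prime_le) supplies enough
primes of each size. *)

(** * A Chebyshev bound for the n-th prime *)


(** In Legendre's formula for the exponent of [p] in a central binomial
    coefficient each power of [p] contributes at most one, and powers beyond
    [n.*2] contribute nothing. *)
Lemma logn_central_bin p n : prime p -> 0 < n ->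
  p ^ logn p 'C(n.*2, n) <= n.*2.
Proof.
move=> pr_p n0; have p1 := prime_gt1 pr_p.
have le_n : n <= n.*2 by lia.
have := congr1 (logn p) (bin_fact le_n).
have ->: n.*2 - n = n by lia.
rewrite lognM ?bin_gt0 ?muln_gt0 ?fact_gt0 // lognM ?fact_gt0 //.
rewrite !logn_fact // => E.
have Ew : \sum_(1 <= k < n.*2.+1) n %/ p ^ k = \sum_(1 <= k < n.+1) n %/ p ^ k.
  rewrite (big_cat_nat (n := n.+1)) //=.
  rewrite [X in _ + X]big_nat [X in _ + X]big1 ?addn0 // => k /andP[nk _].
  apply: divn_small; apply: (leq_ltn_trans (n := k)); first by lia.
  exact: ltn_expl.
have {E Ew} E : logn p 'C(n.*2, n) + \sum_(1 <= k < n.*2.+1) (n %/ p ^ k).*2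
     = \sum_(1 <= k < n.*2.+1) n.*2 %/ p ^ k.
  rewrite -E; congr addn; rewrite -Ew -big_split /=.
  by apply: eq_bigr => k _; rewrite addnn.
set T := trunc_log p n.*2.
have T_le : T < n.*2.+1.
  rewrite ltnS; apply: leq_trans (trunc_logP p1 _); last by lia.
  exact/ltnW/ltn_expl.
have le_T : logn p 'C(n.*2, n) <= T.
  rewrite -(leq_add2r (\sum_(1 <= k < n.*2.+1) (n %/ p ^ k).*2)) E.
  have -> : T = \sum_(1 <= k < n.*2.+1) (k <= T)%N.
    rewrite (big_cat_nat (n := T.+1)) //=.
    rewrite [X in X + _]big_nat (eq_bigr (fun=> 1)); last by move=> i; lia.
    rewrite -big_nat sum_nat_const_nat big_nat big1 /=; first by lia.
    by move=> i; lia.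
  rewrite -big_split /= !big_nat; apply: leq_sum => k /andP[k1 _].
  have pk : 0 < p ^ k by rewrite expn_gt0; lia.
  case: (leqP k T) => [_|kT].
    have : n.*2 %/ p ^ k < (n %/ p ^ k).*2.+2.
      by rewrite ltn_divLR //; have := ltn_ceil n pk; lia.
    by rewrite ltnS; lia.
  rewrite divn_small //; apply: leq_trans (trunc_log_ltn _ p1) _.
  by rewrite leq_exp2l.
apply: leq_trans (trunc_logP p1 _); last by lia.
by rewrite leq_exp2l.
Qed.

Lemma central_bin_ge n : 0 < n -> 2 ^ n.*2 <= n.*2 * 'C(n.*2, n).
Proof.
case: n => // n _; elim: n => [|n IH] //.
move: n.+1 IH => m IH {n}.
have E1 := mul_bin_diag m.*2.+2 m.
have E2 := mul_bin_down m.*2.+1 m.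
rewrite doubleS /= in E1 E2 *.
have -> : m.*2.+2 * 'C(m.*2.+2, m.+1) = 2 * (m.+1 * 'C(m.*2.+2, m.+1)) by lia.
rewrite -E1.
have E3 : m.*2.+1 - m = m.+1 by lia.
rewrite E3 in E2.
have -> : 2 * (m.*2.+2 * 'C(m.*2.+1, m)) = 4 * (m.*2.+1 * 'C(m.*2, m)).
  by rewrite E2; lia.
rewrite !expnS mulnA leq_mul2l /=; apply: leq_trans IH _.
by rewrite leq_mul2r leqnSn orbT.
Qed.

Definition primepi n := count prime (iota 0 n.+1).

Lemma prod_le_exp (s : seq nat) (F : nat -> nat) B :
  {in s, forall x, F x <= B} -> \prod_(x <- s) F x <= B ^ size s.
Proof.
elim: s => [|x s IH] H; first by rewrite big_nil.
rewrite big_cons expnS leq_mul //; first by rewrite H ?mem_head.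
by apply: IH => y ys; rewrite H // in_cons ys orbT.
Qed.

(** The central binomial coefficient is at least [2 ^ n.*2 / n.*2], and it is a
    product of at most [primepi n.*2] prime powers, each at most [n.*2]. *)
Lemma prime_count_ge m : 0 < m -> 2 ^ m <= m * (primepi (2 ^ m)).+1.
Proof.
case: m => // m _; set n := 2 ^ m.
have n0 : 0 < n by rewrite expn_gt0.
have En : 2 ^ m.+1 = n.*2 by rewrite expnS mul2n.
rewrite En; set b := 'C(n.*2, n).
have b0 : 0 < b by rewrite bin_gt0; lia.
have le_b : b <= n.*2 ^ primepi n.*2.
  have : b <= n.*2 ^ size (primes b).
    rewrite {1}(prod_prime_decomp b0) prime_decompE big_map /=.
    apply: prod_le_exp => p; rewrite mem_primes => /and3P[pr_p _ _].
    exact: logn_central_bin.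
  move/leq_trans; apply; rewrite leq_pexp2l ?double_gt0 //.
  rewrite /primepi -size_filter uniq_leq_size ?primes_uniq // => p pb.
  rewrite mem_filter mem_iota.
  move: (pb); rewrite mem_primes => /and3P[pr_p _ pdb]; rewrite pr_p /=.
  rewrite add0n ltnS; apply: leq_trans (logn_central_bin pr_p n0).
  have lp : 0 < logn p b by rewrite logn_gt0.
  by rewrite -{1}(expn1 p) leq_pexp2l // prime_gt0.
have : 2 ^ n.*2 <= 2 ^ (m.+1 * (primepi n.*2).+1).
  apply: leq_trans (central_bin_ge n0) _.
  rewrite mulnS expnD expnM En leq_mul //.
by rewrite leq_exp2l.
Qed.

Lemma next_prime_ex n : exists p, (n < p) && prime p.
Proof. by case: (prime_above n) => p np pp; exists p; rewrite np. Qed.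

Definition next_prime n := ex_minn (next_prime_ex n).

Definition nth_prime k := iter k next_prime 2.

Lemma nth_prime_prime k : prime (nth_prime k).
Proof. by case: k => //= k; rewrite /next_prime; case: ex_minnP => p /andP[]. Qed.

Lemma nth_prime_ltS k : nth_prime k < nth_prime k.+1.
Proof. by rewrite /= /next_prime; case: ex_minnP => p /andP[]. Qed.

Lemma nth_prime_lt : {mono nth_prime : i j / i < j}.
Proof.
apply: leqW_mono; apply: leq_mono; apply: homo_ltn; first exact: ltn_trans.
exact: nth_prime_ltS.
Qed.

Lemma nth_prime_inj : injective nth_prime.
Proof. by apply: incn_inj; apply: leq_mono => i j; rewrite nth_prime_lt. Qed.

Lemma nth_prime_gt k : k < nth_prime k.
Proof. by elim: k => // k IH; apply: leq_ltn_trans IH (nth_prime_ltS _). Qed.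

Lemma count_prime_below k : count prime (iota 0 (nth_prime k)) = k.
Proof.
elim: k => // k IH; have lt := nth_prime_ltS k.
rewrite -(subnKC (ltnW lt)) iotaD count_cat IH add0n.
move: lt; rewrite ![nth_prime k.+1]/= /next_prime; case: ex_minnP => p /andP[kp pp] pmin _.
rewrite -(subnKC kp) addSnnS addKn /= nth_prime_prime.
rewrite (_ : count _ _ = 0) ?addn1 //; apply/eqP.
rewrite -leqn0 leqNgt -has_count; apply/hasP => -[q].
rewrite mem_iota => /andP[kq qp] pq.
have : p <= q by apply: pmin; rewrite kq.
lia.
Qed.

(** The [k]-th prime exceeds [k] only by a logarithmic factor: the condition on
    [w] is met by [w] of order [log a]. *)
Lemma nth_prime_le a w k : 0 < w -> 2 * (a + w) <= 2 ^ w -> k < 2 ^ a ->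
  nth_prime k <= 2 ^ (a + w).
Proof.
move=> w0 aw ka; rewrite leqNgt; apply/negP => lt.
have := @prime_count_ge (a + w); rewrite addn_gt0 w0 orbT => /(_ isT).
have : primepi (2 ^ (a + w)) <= k.
  rewrite -(count_prime_below k) /primepi -(subnKC lt) iotaD count_cat.
  exact: leq_addr.
move=> pik le1.
have : 2 ^ a * 2 ^ w <= (a + w) * 2 ^ a.
  rewrite -expnD; apply: leq_trans le1 _.
  by rewrite leq_mul2l (leq_trans _ ka) ?orbT.
have a0 : 0 < 2 ^ a by rewrite expn_gt0.
rewrite [X in _ <= X]mulnC leq_pmul2l // => le2.
have : 0 < 2 ^ w by rewrite expn_gt0.
lia.
Qed.

(** * Products of distinct primes *)

Lemma prod_primes_dvd (s : seq nat) N : uniq s -> all prime s ->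
  all (dvdn^~ N) s -> \prod_(p <- s) p %| N.
Proof.
elim: s => [|p s IH] /=; first by rewrite big_nil dvd1n.
move=> /andP[ps us] /andP[pp aps] /andP[pN aN].
rewrite big_cons Gauss_dvd ?pN ?IH //.
rewrite prime_coprime // Euclid_dvd_prod // big_has; apply/negP => /hasP[x xs] /=.
rewrite dvdn_prime2 ?(allP aps x xs) // => /eqP ep.
by rewrite ep xs in ps.
Qed.

Lemma prod_ge_exp (s : seq nat) (F : nat -> nat) B :
  {in s, forall x, B <= F x} -> B ^ size s <= \prod_(x <- s) F x.
Proof.
elim: s => [|x s IH] H; first by rewrite big_nil.
rewrite big_cons expnS leq_mul //; first by rewrite H ?mem_head.
by apply: IH => y ys; rewrite H // in_cons ys orbT.
Qed.

Lemma size_prime_divisors (s : seq nat) N : uniq s -> all prime s ->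
  all (dvdn^~ N) s -> 0 < N -> 2 ^ size s <= N.
Proof.
move=> us ps dv N0; apply: leq_trans (dvdn_leq N0 (prod_primes_dvd us ps dv)).
by apply: (@prod_ge_exp s id) => x /(allP ps); apply: prime_gt1.
Qed.

Definition absdiff a b := (a - b) + (b - a).

Lemma dvd_absdiff q a b : (q %| absdiff a b) = (a == b %[mod q]).
Proof.
rewrite /absdiff; case: (leqP a b) => [ab|/ltnW ba].
  by rewrite (eqP ab) add0n eq_sym eqn_mod_dvd.
by rewrite (eqP ba) addn0 eqn_mod_dvd.
Qed.

Lemma absdiff_gt0 a b : (0 < absdiff a b) = (a != b).
Proof. by rewrite /absdiff; lia. Qed.

Lemma absdiff_le a b B : a <= B -> b <= B -> absdiff a b <= B.
Proof. by rewrite /absdiff; lia. Qed.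

(** * Discrete logarithms *)

(** The exponents with respect to a generator of the cyclic group of units
    modulo [q] turn products into sums. *)
Lemma discrete_log q : prime q -> exists ind : nat -> nat,
  (forall a, ind a < q) /\
  (forall s t : seq nat, all (coprime q) s -> all (coprime q) t ->
     \sum_(a <- s) ind a = \sum_(a <- t) ind a ->
     \prod_(a <- s) a = \prod_(a <- t) a %[mod q]).
Proof.
move=> pq.
have [g gE] := cyclicP (field_unit_group_cyclic [set: {unit 'F_q}]%G).
have ex a : exists i, i < q /\ (coprime q a -> (a%:R = val g ^+ i :> 'F_q)%R).
  case: (boolP (coprime q a)) => [cqa|_]; last by exists 0; rewrite prime_gt0.
  have ua : (a%:R : 'F_q)%R \is a GRing.unit.
    by rewrite unitFpE.
  have : FinRing.unit 'F_q ua \in <[g]>%g by rewrite -gE inE.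
  case/cyclePmin => i ig Ei; exists i; split; last first.
    move=> _; have := congr1 val Ei; rewrite /= => ->.
    by rewrite FinRing.val_unitX.
  apply: leq_trans ig _; rewrite orderE -gE.
  rewrite card_finField_unit card_Fp //; lia.
have [ind indP] : exists ind : nat -> nat, forall a, ind a < q /\
    (coprime q a -> (a%:R = val g ^+ (ind a) :> 'F_q)%R).
  pose P a i := (i < q) && (coprime q a ==> ((a%:R : 'F_q)%R == (val g ^+ i)%R)).
  have exP a : exists i, P a i.
    by case: (ex a) => i [iq ci]; exists i; rewrite /P iq; apply/implyP => /ci ->.
  exists (fun a => xchoose (exP a)) => a; have /andP[-> /implyP H] := xchooseP (exP a).
  by split=> // /H /eqP.
exists ind; split=> [a|s t]; first by case: (indP a).
have prodE (u : seq nat) : all (coprime q) u ->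
    ((\prod_(a <- u) a)%:R = val g ^+ (\sum_(a <- u) ind a) :> 'F_q)%R.
  elim: u => [|a u IH] /=; first by rewrite !big_nil.
  case/andP=> ca cu; rewrite !big_cons GRing.natrM GRing.exprD IH //.
  by congr (_ * _)%R; case: (indP a) => _; apply.
move=> cs ct E; have := prodE _ cs; rewrite E -prodE // => /(congr1 val) /=.
by rewrite !val_Fp_nat.
Qed.

(** * Mixed radix expansions *)

Lemma mixed_radix_inj (base D D' : nat -> nat) N :
  (forall i, i < N -> D i < base i) -> (forall i, i < N -> D' i < base i) ->
  \sum_(i < N) D i * \prod_(k < i) base k =
  \sum_(i < N) D' i * \prod_(k < i) base k ->
  forall i, i < N -> D i = D' i.
Proof.
elim: N base D D' => [|N IH] base D D' DB DB' //.
rewrite !big_ord_recl !big_ord0 !muln1.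
have shift (E : nat -> nat) :
    \sum_(i < N) E (bump 0 i) * \prod_(k < bump 0 i) base k =
    base 0 * \sum_(i < N) E i.+1 * \prod_(k < i) base k.+1.
  rewrite big_distrr; apply: eq_bigr => i _ /=.
  rewrite /bump leq0n add1n big_ord_recl /=.
  by rewrite mulnCA.
rewrite /= !shift => E.
have b0 : 0 < base 0 by apply: leq_ltn_trans (DB 0 _).
have E0 : D 0 = D' 0.
  have := congr1 (modn^~ (base 0)) E.
  rewrite (addnC (D 0)) (addnC (D' 0)) !(mulnC (base 0)) !modnMDl.
  by rewrite !modn_small ?DB ?DB'.
move: E; rewrite E0 => /addnI /eqP; rewrite eqn_pmul2l // => /eqP E [//|i] iN.
by apply: (IH (fun i => base i.+1) (fun i => D i.+1) (fun i => D' i.+1)) => // j jN;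
   [apply: DB | apply: DB'].
Qed.

Lemma mixed_radix_lt (base D : nat -> nat) N :
  (forall i, i < N -> D i < base i) ->
  \sum_(i < N) D i * \prod_(k < i) base k < \prod_(k < N) base k.
Proof.
elim: N => [|N IH] DB; first by rewrite !big_ord0.
rewrite !big_ord_recr /=; set S := \sum_(i < N) _; set Q := \prod_(k < N) _.
have SQ : S < Q by apply: IH => i iN; apply: DB; lia.
have : (D N).+1 * Q <= base N * Q by rewrite leq_mul2r DB // orbT.
by rewrite mulSn [Q * _]mulnC; lia.
Qed.

(** * Cancelling common elements *)

Lemma perm_cancel (T : eqType) (s t : seq T) : exists u v w,
  [/\ perm_eq s (u ++ w), perm_eq t (v ++ w) & ~~ has (mem u) v].
Proof.
elim: s => [|x s [u [v [w [su tv uv]]]]].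
  by exists [::], t, [::]; rewrite !cats0; split=> //; apply/hasP => -[x].
have [xv|xv] := boolP (x \in v).
  exists u, (rem x v), (x :: w); split.
  - by rewrite perm_sym (perm_catCA u [:: x] w) /= perm_cons perm_sym.
  - apply: perm_trans tv _; rewrite perm_sym (perm_catCA (rem x v) [:: x] w).
    by rewrite -[_ ++ _ ++ _]cat_cons perm_cat2r perm_sym perm_to_rem.
  - by apply/hasPn => y /mem_rem yv; apply: (hasPn uv).
exists (x :: u), v, w; split=> //; first by rewrite /= perm_cons.
apply/hasPn => y yv; rewrite inE /= negb_or (hasPn uv) // andbT.
by apply: contraNneq xv => <-.
Qed.

(** * Encoding residues by digits *)

Section Code.

(** [j] ranges over labels; the label [j] stands for the number [pr j], which
    gets [ndigits j] digits, one for each of the moduli [q i]. *)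

Variables (h : nat) (q : nat -> nat) (ind : nat -> nat -> nat).
Variables (pr ndigits : nat -> nat).

(** The offset [h * q i] counts: a sum of at most [h] logarithms is below it, so
    the quotient of a digit sum by [h * q i] is the number of summands that have
    an [i]-th digit, and the remainder is the sum of their logarithms. *)
Definition digit j i := if i < ndigits j then h * q i + ind (q i) (pr j) else 0.

(** Large enough for the sum of [h] digits, so that adding [h] codes produces no
    carry. *)
Definition radix i := h * h.+1 * q i.

Definition code j := \sum_(i < ndigits j) digit j i * \prod_(k < i) radix k.

Hypothesis h_gt0 : 0 < h.
Hypothesis q_gt0 : forall i, 0 < q i.
Hypothesis ind_lt : forall i j, ind (q i) (pr j) < q i.

(** Codes with different numbers of digits are compared by padding with zeros,
    the value of [digit] beyond [ndigits j]. *)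
Lemma code_widen N j : ndigits j <= N ->
  code j = \sum_(i < N) digit j i * \prod_(k < i) radix k.
Proof.
move=> le; rewrite /code.
rewrite (big_ord_widen N (fun i => digit j i * \prod_(k < i) radix k) le).
rewrite [RHS](bigID (fun i : 'I_N => i < ndigits j)) /=.
rewrite [X in _ = _ + X]big1 ?addn0 // => i /negbTE ni.
by rewrite /digit ni.
Qed.

Lemma sum_digit (s : seq nat) i : \sum_(j <- s) digit j i =
  count (fun j => i < ndigits j) s * (h * q i) +
  \sum_(j <- s | i < ndigits j) ind (q i) (pr j).
Proof.
rewrite /digit -big_mkcond /= big_split /=.
by rewrite big_const_seq iter_addn_0 mulnC.
Qed.

Lemma sum_ind_le (s : seq nat) i : size s <= h -> 0 < size s ->
  \sum_(j <- s | i < ndigits j) ind (q i) (pr j) < h * q i.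
Proof.
move=> sh s0.
have : \sum_(j <- s | i < ndigits j) ind (q i) (pr j) <= size s * (q i).-1.
  elim: s {sh s0} => [|j s IH]; first by rewrite big_nil.
  rewrite big_cons /=; have := ind_lt i j; have := q_gt0 i.
  case: ifP => _; lia.
have := q_gt0 i; nia.
Qed.

Lemma radix_gt0 i : 0 < radix i.
Proof. by rewrite /radix !muln_gt0 h_gt0 q_gt0. Qed.

Lemma sum_digit_lt (s : seq nat) i : size s <= h ->
  \sum_(j <- s) digit j i < radix i.
Proof.
case: s => [|j0 s0] sh; first by rewrite big_nil radix_gt0.
rewrite sum_digit /radix; have := @sum_ind_le (j0 :: s0) i sh isT.
have := count_size (fun j => i < ndigits j) (j0 :: s0).
set c := count _ _; set S := \sum_(_ <- _ | _) _ => cs lt.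
have ch : c <= h by apply: leq_trans cs sh.
have : c * (h * q i) <= h * (h * q i) by rewrite leq_mul2r ch orbT.
lia.
Qed.

Lemma code_sum_inj (s t : seq nat) : size s <= h -> size t <= h ->
  \sum_(j <- s) code j = \sum_(j <- t) code j -> forall i,
  count (fun j => i < ndigits j) s = count (fun j => i < ndigits j) t /\
  \sum_(j <- s | i < ndigits j) ind (q i) (pr j) =
  \sum_(j <- t | i < ndigits j) ind (q i) (pr j).
Proof.
move=> sh th E i.
pose N := i.+1 + \sum_(j <- s) ndigits j + \sum_(j <- t) ndigits j.
have leN (u : seq nat) j : j \in u -> ndigits j <= \sum_(j <- u) ndigits j.
  by move=> ju; rewrite (big_rem j) //= leq_addr.
have expand u : (forall j, j \in u -> ndigits j <= N) -> \sum_(j <- u) code j =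
    \sum_(k < N) (\sum_(j <- u) digit j k) * \prod_(l < k) radix l.
  move=> uN; under [RHS]eq_bigr do rewrite big_distrl /=.
  rewrite exchange_big /= !big_seq; apply: eq_bigr => j /uN.
  exact: code_widen.
have digE : \sum_(j <- s) digit j i = \sum_(j <- t) digit j i.
  apply: (@mixed_radix_inj radix _ _ N (fun k _ => sum_digit_lt k sh)
     (fun k _ => sum_digit_lt k th)); last by rewrite /N; lia.
  by rewrite -!expand //; move=> j /leN; rewrite /N; lia.
move: digE; rewrite !sum_digit.
have bound u : size u <= h ->
    \sum_(j <- u | i < ndigits j) ind (q i) (pr j) < h * q i.
  case: u => [|j u] uh; last exact: sum_ind_le.
  by rewrite big_nil muln_gt0 h_gt0 q_gt0.
have hq : 0 < h * q i by rewrite muln_gt0 h_gt0 q_gt0.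
move=> digE; split.
  have := congr1 (divn^~ (h * q i)) digE.
  by rewrite !divnMDl // !divn_small ?bound // !addn0.
have := congr1 (modn^~ (h * q i)) digE.
by rewrite !modnMDl !modn_small ?bound.
Qed.

Lemma digit_lt j i : digit j i < radix i.
Proof. by have := @sum_digit_lt [:: j] i h_gt0; rewrite big_seq1. Qed.

Lemma code_lt j : code j < \prod_(i < ndigits j) radix i.
Proof. by apply: mixed_radix_lt => i _; apply: digit_lt. Qed.

Lemma code_ge j : 0 < ndigits j -> \prod_(i < ndigits j) q i <= code j.
Proof.
rewrite /code => l0; have El : ndigits j = (ndigits j).-1.+1 by lia.
rewrite El !big_ord_recr /=; apply: leq_trans (leq_addl _ _).
rewrite mulnC leq_mul //.
  rewrite /digit El leqnn; have := q_gt0 (ndigits j).-1; nia.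
by apply: leq_prod => i _; rewrite /radix; have := q_gt0 i; nia.
Qed.

End Code.

(** Counting the elements with an [i]-th digit, for all [i], recovers the
    multiset of levels, because the number of digits determines the level. *)
Lemma perm_levels (level d : nat -> nat) (u v : seq nat) :
  {mono d : x y / x < y} -> 0 < d 0 ->
  (forall i, count (fun j => i < d (level j)) u =
             count (fun j => i < d (level j)) v) ->
  perm_eq [seq level j | j <- u] [seq level j | j <- v].
Proof.
move=> dm d0 H; apply/allP => k _; apply/eqP.
change (count_mem k [seq level j | j <- u] =
        count_mem k [seq level j | j <- v]).
have above x : count (fun j => x < level j) u = count (fun j => x < level j) v.
  by have := H (d x); under eq_count do rewrite dm; under [RHS]eq_count do rewrite dm.
have geq : count (fun j => k <= level j) u = count (fun j => k <= level j) v.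
  case: k => [|k]; last exact: above.
  have pos x : 0 < d x by case: x => // x; apply: leq_ltn_trans (_ : d 0 < _); rewrite ?dm.
  have := H 0; rewrite (eq_count (a2 := predT)) => [|j]; last by rewrite pos.
  rewrite [RHS](eq_count (a2 := predT)) => [|j]; last by rewrite pos.
  by move=> E; rewrite [LHS](eq_count (a2 := predT)) // [RHS](eq_count (a2 := predT)).
have split s : count (fun j => k <= level j) s =
    count_mem k [seq level j | j <- s] + count (fun j => k < level j) s.
  by elim: s => //= j s ->; lia.
by have := split u; have := split v; rewrite geq above; lia.
Qed.

(** * Binary length *)

Definition bitlen n := (trunc_log 2 n).+1.

Lemma ltn_bitlen n : n < 2 ^ bitlen n.
Proof. exact: trunc_log_ltn. Qed.

Lemma leq_bitlen : {homo bitlen : m n / m <= n}.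
Proof. by move=> m n mn; rewrite ltnS leq_trunc_log. Qed.

Lemma bitlen_leq n : 0 < n -> bitlen n <= n.
Proof.
move=> n0; apply: leq_trans (trunc_logP (p := 2) isT n0).
exact: ltn_expl.
Qed.

Lemma bitlenS n : bitlen n.+1 <= (bitlen n).+1.
Proof.
rewrite ltnS -(leq_exp2l (m := 2)) //.
have := trunc_logP (p := 2) isT (ltn0Sn n); have := ltn_bitlen n.
by rewrite /bitlen; set a := trunc_log 2 n.+1; set b := trunc_log 2 n; lia.
Qed.

(** * Windows for the moduli *)

(** [r i] is the index of the [i]-th modulus in the sequence of primes.  With
    indices in disjoint windows the moduli are automatically distinct and there
    are exactly [2 ^ (2 * i).+1] candidates for the [i]-th one, while its size is
    known up to a logarithmic factor. *)
Definition admissible (r : nat -> nat) :=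
  forall i, 2 ^ (2 * i).+1 <= r i < 2 ^ (2 * i).+2.

Lemma admissible_inj r : admissible r -> injective r.
Proof.
move=> ar i j e; have := ar i; rewrite e => /(trunc_log_eq (isT : 1 < 2)).
by have /(trunc_log_eq (isT : 1 < 2)) -> := ar j; lia.
Qed.

Lemma prod_odd_powers k : \prod_(i < k) 2 ^ (2 * i).+1 = 2 ^ (k ^ 2).
Proof.
elim: k => [|k IH]; first by rewrite big_ord0.
rewrite big_ord_recr /= IH -expnD; congr (2 ^ _); lia.
Qed.

Lemma prod_exp2 (s : seq nat) (F : nat -> nat) :
  \prod_(j <- s) 2 ^ F j = 2 ^ \sum_(j <- s) F j.
Proof.
by elim: s => [|j s IH]; rewrite ?big_nil // !big_cons IH expnD.
Qed.

Lemma leq_prod_seq (s : seq nat) (P : pred nat) (F G : nat -> nat) :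
  {in s, forall j, F j <= G j} ->
  \prod_(j <- s | P j) F j <= \prod_(j <- s | P j) G j.
Proof.
move=> FG; rewrite big_seq_cond [X in _ <= X]big_seq_cond.
by elim/big_ind2: _ => // [a b a' b' H H'|j /andP[/FG]//]; apply: leq_mul.
Qed.

Lemma card_ord_itv a b M : a <= b -> b <= M ->
  #|[pred x : 'I_M | a <= x < b]| = b - a.
Proof.
move=> ab bM; rewrite -sum1_card (eq_bigl (fun x : 'I_M => a <= x < b)) //.
rewrite -(big_mkord (fun x => a <= x < b) (fun=> 1)) /=.
rewrite -(big_nat_widen 0 b M (fun x => a <= x)) //.
rewrite -(big_nat_widenl a 0 b xpredT) //.
by rewrite sum_nat_const_nat muln1.
Qed.

Lemma card_familyE (I J : finType) (F : I -> pred J) :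
  #|family F| = \prod_i #|F i|.
Proof. by rewrite card_family foldrE big_map enumT. Qed.

Lemma sum_mem_ord N (s : seq nat) : \sum_(j < N) (val j \in s : nat) <= size s.
Proof.
rewrite -big_mkcond /= sum1_card cardE -(size_map val).
apply: uniq_leq_size; first by rewrite (map_inj_uniq val_inj) enum_uniq.
by move=> _ /mapP[j + ->]; rewrite mem_enum.
Qed.

(** Sequences of length [l] over a finite alphabet, as finite functions: sums over
    all words can then be factored by distributivity. *)
Definition word l N (f : {ffun 'I_l -> 'I_N}) : seq nat :=
  [seq val (f i) | i <- enum 'I_l].

Lemma size_word l N (f : {ffun 'I_l -> 'I_N}) : size (word f) = l.
Proof. by rewrite size_map size_enum_ord. Qed.

Lemma word_ex l N s : size s = l -> all (fun x => x < N) s -> 0 < N ->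
  exists f : {ffun 'I_l -> 'I_N}, word f = s.
Proof.
move=> sl sN N0; exists [ffun i : 'I_l => insubd (Ordinal N0) (nth 0 s i)].
apply: (@eq_from_nth _ 0); rewrite size_word // => i il.
rewrite (nth_map (Ordinal il)) ?size_enum_ord // ffunE /= nth_enum_ord // insubdK //.
by apply: (allP sN); rewrite mem_nth // sl.
Qed.

Lemma big_word (S : Type) (idx : S) (op : Monoid.com_law idx) l N
    (f : {ffun 'I_l -> 'I_N}) (F : nat -> S) :
  \big[op/idx]_(x <- word f) F x = \big[op/idx]_(i < l) F (f i).
Proof. by rewrite big_map big_enum. Qed.

Section Windows.

Variable K : nat.

Definition window (i : 'I_K) :=
  [pred x : 'I_(2 ^ (2 * K)) | 2 ^ (2 * i).+1 <= x < 2 ^ (2 * i).+2].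

Lemma card_window i : #|window i| = 2 ^ (2 * i).+1.
Proof.
rewrite card_ord_itv ?leq_exp2l //; last by have := ltn_ord i; lia.
by rewrite [2 ^ (2 * i).+2]expnS mul2n -addnn addnK.
Qed.

(** The default value beyond [K] only keeps the sequence admissible. *)
Definition extend (f : {ffun 'I_K -> 'I_(2 ^ (2 * K))}) i : nat :=
  if insub i is Some o then val (f o) else 2 ^ (2 * i).+1.

Lemma extend_ord f (i : 'I_K) : extend f i = f i.
Proof. by rewrite /extend valK. Qed.

Lemma admissible_extend f : f \in family window -> admissible (extend f).
Proof.
move=> /familyP ff i; rewrite /extend; case: insubP => [x _ <- | _].
  by have := ff x; rewrite inE.
by rewrite leqnn ltn_exp2l //=.
Qed.

Lemma family_window_gt0 : 0 < #|family window|.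
Proof. by rewrite card_familyE prodn_gt0 // => i; rewrite card_window expn_gt0. Qed.

End Windows.

(** * Compactness *)

(** The windows are finite, so Koenig's lemma applies: a prefix that extends to
    arbitrarily good sequences has an extension by one term with this property. *)
Lemma compactness (lo hi d : nat -> nat) (G : nat -> (nat -> nat) -> Prop) :
  (forall n r r', (forall i, i < d n -> r i = r' i) -> G n r -> G n r') ->
  (forall n1, exists r, (forall i, lo i <= r i < hi i) /\
                        (forall n, n <= n1 -> G n r)) ->
  exists r, (forall i, lo i <= r i < hi i) /\ (forall n, G n r).
Proof.
move=> Gloc Gfin; pose upd (r : nat -> nat) k x i := if i == k then x else r i.
pose E k r := forall n1, exists r', [/\ forall i, lo i <= r' i < hi i,
   forall i, i < k -> r' i = r i & forall n, n <= n1 -> G n r'].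
have step k r : E k r -> exists x, E k.+1 (upd r k x).
  move=> Ek; apply: contrapT => /forallNP no.
  have /choice[N HN] : forall x, exists n1, ~ exists r',
      [/\ forall i, lo i <= r' i < hi i,
      forall i, i < k.+1 -> r' i = upd r k x i & forall n, n <= n1 -> G n r'].
    by move=> x; apply/existsNP; apply: no.
  have [r' [ar er Gr]] := Ek (\max_(x < hi k) N x).
  have xk : r' k < hi k by case/andP: (ar k).
  apply: (HN (r' k)); exists r'; split=> // [i|n nN].
    rewrite ltnS leq_eqVlt /upd => /predU1P[->|ik]; first by rewrite eqxx.
    by rewrite ltn_eqF // er.
  apply: Gr; apply: leq_trans nN _.
  exact: (@leq_bigmax _ (fun x : 'I_(hi k) => N x) (Ordinal xk)).
pose rs := fix rs k := if k is k'.+1 then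
   upd (rs k') k' (xget 0 [set x | E k (upd (rs k') k' x)]%classic) else lo.
have Ers k : E k (rs k).
  elim: k => [|k /step[x Ex]]; first by move=> n1; have [r [ar Gr]] := Gfin n1; exists r.
  by rewrite /=; case: xgetP => [y _ //|/(_ x)].
have stable k i : i < k -> rs k i = rs i.+1 i.
  elim: k => // k IH; rewrite ltnS leq_eqVlt => /predU1P[->//|ik].
  by rewrite [LHS]/= /upd ltn_eqF // IH.
exists (fun i => rs i.+1 i); split=> [i|n].
  have [r [ar er _]] := Ers i.+1 0; rewrite -er //.
have [r [ar er Gr]] := Ers (d n) n.
by apply: Gloc (Gr n (leqnn _)) => i il; rewrite er // stable.
Qed.

Section Construction.

(** * Levels *)

Variables (R : realType) (c : R) (h : nat).

(** Level [n] consists of the [2 ^ mu n] primes whose index in the sequence of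
    primes is at least [2 ^ mu n] and below [2 ^ (mu n).+1].  They are at most
    [2 ^ lam n], where [lam n] is the integer part of [c n^2]: the deficit
    [2 * bitlen n + 2] pays for the logarithm in Chebyshev's bound.  They get
    [ndigits n] digits; the surplus [slack n] over [n] pays for the number of
    shapes of a collision and for the number of prime divisors of an integer.
    The factor [4 * h + 7] is what slack_budget requires. *)

Definition slack n := (4 * h + 7) * bitlen n.
Definition ndigits n := n + slack n.
Definition lam n := Num.truncn (c * n%:R ^+ 2)%R.
Definition mu n := lam n - (2 * bitlen n + 2).

Hypothesis c_gt0 : (0 < c)%R.
Hypothesis c_le1 : (c <= 1)%R.

Lemma c_sqr_ge0 n : (0 <= c * n%:R ^+ 2)%R.
Proof. by rewrite mulr_ge0 ?exprn_ge0 ?ler0n // ltW. Qed.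

Lemma lam_le n : ((lam n)%:R <= c * n%:R ^+ 2)%R.
Proof. by rewrite truncn_le // c_sqr_ge0. Qed.

Lemma lam_gt n : (c * n%:R ^+ 2 < (lam n).+1%:R)%R.
Proof. exact: truncnS_gt. Qed.

Lemma leq_lam : {homo lam : m n / m <= n}.
Proof.
move=> m n mn; apply: le_truncn.
rewrite ler_pM2l // ler_pXn2r ?nnegrE ?ler0n // ler_nat //.
Qed.

Lemma lam_leq_sqr n : lam n <= n ^ 2.
Proof.
rewrite -(ler_nat R); apply: le_trans (lam_le n) _.
by rewrite natrX ler_piMl ?exprn_ge0 ?ler0n.
Qed.

Lemma leq_ndigits : {homo ndigits : m n / m <= n}.
Proof. by move=> m n mn; rewrite leq_add // leq_mul2l leq_bitlen ?orbT. Qed.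

Lemma ndigits_mono : {mono ndigits : m n / m < n}.
Proof.
apply: leqW_mono; apply: leq_mono => m n mn.
by rewrite -addSn leq_add // leq_mul2l leq_bitlen ?orbT // ltnW.
Qed.

Lemma ndigits_gt0 : 0 < ndigits 0.
Proof. by rewrite /ndigits /slack /bitlen; lia. Qed.

(** Levels start at [n0], chosen so large that consecutive levels are disjoint
    and that the primes of level [n] exceed their moduli. *)
Variable n0 : nat.
Hypothesis n0_large : (((2 * (4 * h + 7) + 7)%:R : R) <= c * n0%:R)%R.

Lemma n0_gt0 : 0 < n0.
Proof.
rewrite lt0n; apply/eqP => e; move: n0_large; rewrite e mulr0 (ler_nat R _ 0).
by lia.
Qed.

Lemma large_n n : n0 <= n -> (((2 * (4 * h + 7) + 7)%:R : R) <= c * n%:R)%R.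
Proof.
by move=> nn; apply: le_trans n0_large _; rewrite ler_pM2l // ler_nat.
Qed.

Lemma lam_mu n : n0 <= n -> 2 * ndigits n + (2 * bitlen n + 2) <= lam n.
Proof.
move=> nn; have := large_n nn; have n_gt0 : 0 < n by apply: leq_trans n0_gt0 nn.
have := bitlen_leq n_gt0; have := lam_gt n; rewrite /ndigits /slack.
set A := 4 * h + 7 => lg el An.
rewrite -ltnS -(ltr_nat R); apply: le_lt_trans lg.
(* The two terms on the left are bounded by multiples of [n] since
   [bitlen n <= n]; this is where the constant in [n0_large] comes from. *)
have : (((2 * A + 7) * n)%:R <= c * n%:R ^+ 2 :> R)%R.
  by rewrite natrM expr2 mulrA ler_pM2r // ltr0n.
apply: le_trans; rewrite ler_nat; nia.
Qed.

Lemma lamE n : n0 <= n -> lam n = mu n + (2 * bitlen n + 2).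
Proof. by move/lam_mu; rewrite /mu; lia. Qed.

Lemma ndigits_mu n : n0 <= n -> 2 * ndigits n <= mu n.
Proof. by move/lam_mu; rewrite /mu; lia. Qed.

Lemma mu_ltS n : n0 <= n -> mu n < mu n.+1.
Proof.
move=> nn; have := lamE nn; have := lamE (leqW nn); have := bitlenS n.
suff : lam n + 4 < (lam n.+1).+1 by lia.
rewrite -(ltr_nat R); apply: le_lt_trans (lam_gt _).
have := lam_le n; have := large_n nn; have := c_gt0.
rewrite natrD -[n.+1]addn1 natrD; set x := (n%:R)%R; set y := (_%:R)%R => cp cx lx.
have : (7 <= y)%R by rewrite /y (ler_nat R 7); lia.
nra.
Qed.

Lemma mu_lt m n : n0 <= m -> m < n -> mu m < mu n.
Proof.
move=> nm; elim: n => // n IH; rewrite ltnS leq_eqVlt => /predU1P[<-|mn].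
  exact: mu_ltS.
by apply: ltn_trans (IH mn) (mu_ltS _); lia.
Qed.

Definition in_level n j := (n0 <= n) && (2 ^ mu n <= j < 2 ^ (mu n).+1).

Lemma card_in_level n k : n0 <= k -> mu k <= mu n ->
  #|[pred j : 'I_(2 ^ (mu n).+1) | in_level k j]| = 2 ^ mu k.
Proof.
move=> nk mk.
rewrite (eq_card (B := [pred x : 'I_(2 ^ (mu n).+1) |
   2 ^ mu k <= x < 2 ^ (mu k).+1])); last first.
  by move=> j; rewrite !inE /in_level nk.
have b1 : 2 ^ mu k <= 2 ^ (mu k).+1 by rewrite leq_exp2l.
have b2 : 2 ^ (mu k).+1 <= 2 ^ (mu n).+1 by rewrite leq_exp2l.
rewrite (card_ord_itv b1 b2).
by rewrite [2 ^ (mu k).+1]expnS mul2n -addnn addnK.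
Qed.

Lemma in_level_inj m n j : in_level m j -> in_level n j -> m = n.
Proof.
have mu_eq k : in_level k j -> n0 <= k /\ trunc_log 2 j = mu k.
  by case/andP=> nk jk; split=> //; apply: trunc_log_eq.
move=> /mu_eq[nm Em] /mu_eq[nn En].
case: (ltngtP m n) => // lt; have := mu_lt _ lt.
  by rewrite -Em -En ltnn => /(_ nm).
by rewrite -Em -En ltnn => /(_ nn).
Qed.

Lemma nth_prime_lam n j : in_level n j -> nth_prime j <= 2 ^ lam n.
Proof.
case/andP => nn /andP[_ jn]; have E := lamE nn.
have -> : lam n = (mu n).+1 + (2 * bitlen n).+1 by lia.
apply: nth_prime_le => //; have -> : (mu n).+1 + (2 * bitlen n).+1 = lam n by lia.
rewrite expnS leq_mul2l /=; apply: leq_trans (lam_leq_sqr n) _.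
by rewrite mulnC expnM leq_exp2r // ltnW // ltn_bitlen.
Qed.

(** [h * lam n] bounds the number of prime divisors of any difference of products
    of primes that matters at level [n]. *)
Lemma mul_lam_le n : h * lam n <= 2 ^ slack n.
Proof.
apply: (leq_trans (n := 2 ^ h * 2 ^ (2 * bitlen n))).
  apply: leq_mul; first exact/ltnW/ltn_expl.
  apply: leq_trans (lam_leq_sqr n) _.
  by rewrite mulnC expnM leq_exp2r // ltnW // ltn_bitlen.
by rewrite -expnD leq_exp2l // /slack /bitlen; nia.
Qed.

(** The left hand side collects the losses at level [n]: the position of the
    spoiled element, the number of terms, the levels of the terms, the gap between
    [lam n] and [mu n], and a factor [2 ^ (n + 2)] that makes the averages summable
    over [n]. *)
Lemma slack_budget n : n0 <= n ->
  h * h.+1 * n.+1 ^ (2 * h) * 2 ^ (lam n + (n + 2)) <= 2 ^ (mu n + n * slack n).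
Proof.
move=> nn; rewrite (lamE nn).
have n_gt0 : 0 < n by apply: leq_trans n0_gt0 nn.
apply: (leq_trans (n := 2 ^ (2 * h) * 2 ^ (bitlen n * (2 * h)) *
   2 ^ (mu n + (2 * bitlen n + 2) + (n + 2)))).
  have h1 : h <= 2 ^ h by apply/ltnW/ltn_expl.
  have h2 : h.+1 <= 2 ^ h by apply/ltn_expl.
  have h3 : n.+1 ^ (2 * h) <= (2 ^ bitlen n) ^ (2 * h).
    by case: (posnP h) => [->|hp]; rewrite ?muln0 ?expn0 // leq_exp2r ?ltn_bitlen //; lia.
  have h4 : 2 ^ (2 * h) = 2 ^ h * 2 ^ h by rewrite -expnD addnn mul2n.
  rewrite leq_mul2r (expnM _ (bitlen n)) h4; apply/orP; right.
  by apply: leq_mul h3; apply: leq_mul.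
have : 0 < bitlen n by [].
by rewrite -!expnD leq_exp2l // /slack; nia.
Qed.

(** The value [0] outside all levels is a default: every use comes with
    [in_level (level j) j]. *)
Definition level j := xget 0 [set n | in_level n j]%classic.

Lemma levelE n j : in_level n j -> level j = n.
Proof.
move=> jn; rewrite /level; case: xgetP => [m _ jm|/(_ n)//].
exact: in_level_inj jm jn.
Qed.

(** * Collisions and the energy bound *)

(** The shape of an equality between two sums of codes with top level [n], after
    cancellation of common terms; it does not involve the moduli. *)
Definition rival n (u v : seq nat) :=
  [&& size u <= h,
      all (fun j => in_level (level j) j && (level j <= n)) (u ++ v),
      has (fun j => level j == n) u,
      ~~ has (mem u) v &
      perm_eq [seq level j | j <- u] [seq level j | j <- v]].

Definition active i (u : seq nat) :=
  \prod_(j <- u | i < ndigits (level j)) nth_prime j.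

(** What equality of the digits says modulo the [i]-th modulus, for each [i]. *)
Definition collide r n u v :=
  all (fun i => nth_prime (r i) %| absdiff (active i u) (active i v))
      (iota 0 (ndigits n)).

(** Unique factorization keeps the differences in [collide] nonzero. *)
Lemma prod_nth_prime_neq (P : pred nat) u v j : j \in u -> P j -> ~~ has (mem u) v ->
  \prod_(k <- u | P k) nth_prime k != \prod_(k <- v | P k) nth_prime k.
Proof.
move=> ju Pj uv; apply/eqP => E.
have : nth_prime j %| \prod_(k <- v | P k) nth_prime k.
  by rewrite -E (big_rem j ju) /= Pj dvdn_mulr.
rewrite Euclid_dvd_prod ?nth_prime_prime // big_has_cond => /hasP[k kv] /andP[_].
rewrite dvdn_prime2 ?nth_prime_prime // => /eqP/nth_prime_inj jk.
by move/hasPn: uv => /(_ k kv); rewrite -jk /= ju.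
Qed.

Lemma prod_nth_prime_le (P : pred nat) u : all (fun j => in_level (level j) j) u ->
  \prod_(k <- u | P k) nth_prime k <= 2 ^ \sum_(k <- u) lam (level k).
Proof.
move=> au; rewrite -prod_exp2; apply: (leq_trans (n := \prod_(k <- u) nth_prime k)).
  rewrite big_mkcond; elim: u {au} => [|k u IH]; first by rewrite !big_nil.
  rewrite !big_cons /=; apply: leq_mul IH.
  by case: ifP => // _; rewrite prime_gt0 ?nth_prime_prime.
by apply: leq_prod_seq => j /(allP au); apply: nth_prime_lam.
Qed.

(** Below [ndigits m], with [m] the lowest level, all the primes have a digit; so
    the product of these moduli divides the nonzero difference of the two full
    products, which is at most [2 ^ S] with [S] the sum of the [lam (level j)]. *)
Lemma energy_sqr_le r n u v m : admissible r -> rival n u v -> collide r n u v ->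
  m \in [seq level j | j <- u] ->
  (forall j, j \in u -> m <= level j) ->
  ndigits m ^ 2 <= \sum_(j <- u) lam (level j).
Proof.
move=> ar /and5P[_]; rewrite all_cat => /andP[au av] _ uv lev_uv col mu_ m_min.
have v_min j : j \in v -> m <= level j.
  move=> jv; have : level j \in [seq level k | k <- u].
    by rewrite (perm_mem lev_uv) map_f.
  by case/mapP => k ku ->; apply: m_min.
have [j0 ju Em] := mapP mu_.
have mn : ndigits m <= ndigits n.
  by apply: leq_ndigits; rewrite Em; have /andP[] := allP au _ ju.
have lev_sum : \sum_(j <- u) lam (level j) = \sum_(j <- v) lam (level j).
  by rewrite -!(big_map level predT lam); apply: perm_big.
have act_u i : i < ndigits m -> active i u = \prod_(j <- u) nth_prime j.
  move=> im; rewrite /active big_seq_cond [RHS]big_seq; apply: eq_bigl => j.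
  rewrite andbC; case: (boolP (j \in u)) => [/m_min mj|]; last by rewrite andbF.
  by rewrite (leq_trans im) // leq_ndigits.
have act_v i : i < ndigits m -> active i v = \prod_(j <- v) nth_prime j.
  move=> im; rewrite /active big_seq_cond [RHS]big_seq; apply: eq_bigl => j.
  rewrite andbC; case: (boolP (j \in v)) => [/v_min mj|]; last by rewrite andbF.
  by rewrite (leq_trans im) // leq_ndigits.
set N := absdiff (\prod_(j <- u) nth_prime j) (\prod_(j <- v) nth_prime j).
have N_gt0 : 0 < N by rewrite absdiff_gt0 (@prod_nth_prime_neq predT _ _ j0).
have N_le : N <= 2 ^ \sum_(j <- u) lam (level j).
  apply: absdiff_le; last rewrite lev_sum; apply: (@prod_nth_prime_le predT).
    by apply: sub_all au => j /andP[].
  by apply: sub_all av => j /andP[].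
have : \prod_(p <- [seq nth_prime (r i) | i <- iota 0 (ndigits m)]) p %| N.
  apply: prod_primes_dvd.
  - rewrite map_inj_uniq ?iota_uniq // => i j /nth_prime_inj.
    exact: admissible_inj.
  - by apply/allP => _ /mapP[i _ ->]; apply: nth_prime_prime.
  - apply/allP => _ /mapP[i im ->] /=; move: im; rewrite mem_iota add0n /= => im.
    have := allP col i; rewrite mem_iota add0n /= (leq_trans im mn) => /(_ isT).
    by rewrite act_u ?act_v.
move/(dvdn_leq N_gt0) => le_N.
rewrite -(leq_exp2l (m := 2)) //; apply: leq_trans N_le; apply: leq_trans le_N.
have -> : iota 0 (ndigits m) = index_iota 0 (ndigits m) by rewrite /index_iota subn0.
rewrite big_map big_mkord.
rewrite -prod_odd_powers; apply: leq_prod => i _.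
by apply: leq_trans (ltnW (nth_prime_gt _)); case/andP: (ar i).
Qed.

Hypothesis c_eq : (c ^+ 2 + 2 * (h%:R - 1) * c = 1)%R.
Hypothesis h_gt1 : 1 < h.

(** One term has the lowest level [m], the others at most level [n], so
    [S <= lam m + (h - 1) lam n]; and [lam m <= c m^2 <= c S] by energy_sqr_le.
    Solving for [S] gives the bound exactly when [c] satisfies [c_eq]. *)
Lemma energy_le r n u v : admissible r -> rival n u v -> collide r n u v ->
  2 * (\sum_(j <- u) lam (level j)) <= n ^ 2 + lam n.
Proof.
move=> ar riv col; have /and5P[uh] := riv; rewrite all_cat => /andP[au av] hu _ _.
have ex : exists x, x \in [seq level j | j <- u].
  by have /hasP[j ju _] := hu; exists (level j); rewrite map_f.
case: (ex_minnP ex) => m mlev m_min.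
have mle j : j \in u -> m <= level j by move=> ju; apply: m_min; rewrite map_f.
have sq := energy_sqr_le ar riv col mlev mle.
have [j0 ju Em] := mapP mlev.
set S := \sum_(j <- u) lam (level j) in sq *.
have S_le : S <= lam m + h.-1 * lam n.
  rewrite /S (big_rem j0 ju) /= Em leq_add2l.
  apply: (leq_trans (n := size (rem j0 u) * lam n)); last first.
    rewrite leq_mul2r size_rem //; apply/orP; right.
    by rewrite -!subn1 leq_sub2r.
  rewrite -sum1_size big_distrl /= !big_seq; apply: leq_sum => j /mem_rem ju'.
  by rewrite mul1n; apply: leq_lam; have /andP[] := allP au _ ju'.
have lamm : ((lam m)%:R <= c * S%:R)%R.
  apply: le_trans (lam_le m) _; rewrite ler_pM2l // -natrX ler_nat.
  by apply: leq_trans sq; rewrite leq_exp2r // leq_addr.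
have lamn := lam_le n.
have : (S%:R <= (lam m)%:R + (h%:R - 1) * (lam n)%:R :> R)%R.
  have -> : (h%:R - 1 = h.-1%:R :> R)%R by rewrite -subn1 natrB // ltnW.
  by rewrite -natrM -natrD ler_nat.
rewrite -(ler_nat R) natrM natrD natrX.
have h1 : (2 <= h%:R :> R)%R by rewrite (ler_nat R 2).
move: lamm lamn c_eq c_gt0.
set s := (S%:R)%R; set a := ((lam m)%:R)%R; set L := ((lam n)%:R)%R.
set x := (n%:R ^+ 2)%R; set k := (h%:R - 1)%R => ac Lc ce cp sl.
have L0 : (0 <= L)%R by rewrite /L ler0n.
have e1 : ((1 - c) * s <= k * L)%R by nra.
have e2 : (2 * c * ((1 - c) * s) <= (1 - c ^+ 2) * L)%R.
  have -> : (1 - c ^+ 2 = 2 * k * c)%R by move: ce; lra.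
  have -> : (2 * k * c * L = 2 * c * (k * L))%R by ring.
  by rewrite ler_pM2l // mulr_gt0.
have k1 : (1 <= k)%R by rewrite /k; lra.
have c1 : (0 < 1 - c)%R by nra.
have e3 : (2 * c * s <= (1 + c) * L)%R.
  rewrite -(ler_pM2l c1); move: e2; lra.
have : (c * (2 * s) <= c * (x + L))%R by lra.
by rewrite ler_pM2l.
Qed.

(** * Averaging over the moduli *)

Section Count.

Variables (K n : nat).
Hypothesis lenK : ndigits n <= K.
Hypothesis n0n : n0 <= n.

Lemma absdiff_active u v i : rival n u v -> i < ndigits n ->
  0 < absdiff (active i u) (active i v) <= 2 ^ (h * lam n).
Proof.
move=> riv il; have /and5P[uh] := riv; rewrite all_cat => /andP[au av] hu uv lev_uv.
have vh : size v <= h.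
  by rewrite -(size_map level) -(perm_size lev_uv) size_map.
apply/andP; split.
  have /hasP[j ju /eqP jn] := hu.
  by rewrite absdiff_gt0 (@prod_nth_prime_neq _ _ _ j) // jn.
have bound w : size w <= h -> all (fun j => in_level (level j) j && (level j <= n)) w ->
    active i w <= 2 ^ (h * lam n).
  move=> wh aw; rewrite /active; apply: leq_trans (prod_nth_prime_le _ _) _.
    by apply: sub_all aw => j /andP[].
  rewrite leq_exp2l //; apply: (leq_trans (n := size w * lam n)); last first.
    by rewrite leq_mul2r wh orbT.
  rewrite -sum1_size big_distrl /= !big_seq; apply: leq_sum => j jw.
  by rewrite mul1n; apply: leq_lam; have /andP[] := allP aw _ jw.
by apply: absdiff_le; apply: bound.
Qed.

(** For [i < ndigits n] at most [2 ^ slack n] of the [2 ^ (2 * i).+1] candidates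
    divide the nonzero difference; the product of these ratios is
    [2 ^ (ndigits n * slack n - ndigits n ^ 2)], and
    [ndigits n ^ 2 - ndigits n * slack n = n * ndigits n]. *)
Lemma count_collide u v : rival n u v ->
  #|[pred f in family (@window K) | collide (extend f) n u v]| *
    2 ^ (n ^ 2 + n * slack n) <= #|family (@window K)|.
Proof.
move=> riv.
pose N i := absdiff (active i u) (active i v).
pose W (i : 'I_K) : pred 'I_(2 ^ (2 * K)) :=
  [pred x | window i x && ((i < ndigits n) ==> (nth_prime x %| N i))].
have sub : #|[pred f in family (@window K) | collide (extend f) n u v]| <= #|family W|.
  apply/subset_leq_card/fintype.subsetP => f; rewrite inE => /andP[/familyP ff col].
  apply/familyP => i; rewrite inE /=; have := ff i; rewrite inE => -> /=.
  apply/implyP => il; have := allP col i; rewrite mem_iota add0n il => /(_ isT).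
  by rewrite extend_ord.
have cardW (i : 'I_K) : i < ndigits n -> #|W i| <= 2 ^ slack n.
  move=> il; have /andP[N0 N_le] := absdiff_active riv il.
  apply: leq_trans (mul_lam_le n); rewrite -(leq_exp2l (m := 2)) //.
  apply: leq_trans N_le; rewrite cardE -(size_map (nth_prime \o val)).
  apply: size_prime_divisors => //.
  - rewrite map_inj_uniq ?enum_uniq //.
    by apply: inj_comp; [apply: nth_prime_inj | apply: val_inj].
  - by apply/allP => _ /mapP[x _ ->]; apply: nth_prime_prime.
  - apply/allP => _ /mapP[x + ->]; rewrite mem_enum inE /= il => /andP[_].
    by [].
have fac (i : 'I_K) : #|W i| * (if i < ndigits n then 2 ^ (2 * i).+1 else 1) <=
    #|window i| * (if i < ndigits n then 2 ^ slack n else 1).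
  case: ifP => il; first by rewrite card_window mulnC leq_mul2l cardW ?orbT.
  by rewrite !muln1; apply/subset_leq_card/fintype.subsetP => x; rewrite inE => /andP[].
have prodE (F : nat -> nat) : \prod_(i < K) (if i < ndigits n then F i else 1) =
    \prod_(i < ndigits n) F i.
  by rewrite -big_mkcond /= -(big_ord_widen K F lenK).
have : #|family W| * 2 ^ (ndigits n ^ 2) <=
    #|family (@window K)| * 2 ^ (ndigits n * slack n).
  rewrite !card_familyE -prod_odd_powers -(prodE (fun i => 2 ^ (2 * i).+1)).
  have -> : 2 ^ (ndigits n * slack n) = \prod_(i < ndigits n) 2 ^ slack n.
    by rewrite prod_nat_const card_ord -expnM mulnC.
  rewrite -(prodE (fun=> 2 ^ slack n)) -!big_split /=.
  by apply: leq_prod => i _; apply: fac.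
have -> : ndigits n ^ 2 = n ^ 2 + n * slack n + ndigits n * slack n.
  by rewrite /ndigits; lia.
rewrite [X in _ * X <= _]expnD mulnA leq_pmul2r ?expn_gt0 //.
by apply: leq_trans; rewrite leq_mul2r sub orbT.
Qed.

Local Notation N := (2 ^ (mu n).+1).

(** Rankin's trick: an element of level [k] gets the weight [2 ^- lam k], so each
    level has total weight at most one, while a word whose exponents sum to [S]
    has weight at least [2 ^- S]. *)
Definition weight (j : nat) : R :=
  (\sum_(k < n.+1) if in_level k j then 2 ^- lam k else 0)%R.

Lemma weight_ge0 j : (0 <= weight j)%R.
Proof. by apply: sumr_ge0 => k _; case: ifP => // _; rewrite invr_ge0 exprn_ge0. Qed.

Lemma weight_ge j : in_level (level j) j -> level j <= n ->
  (2 ^- lam (level j) <= weight j)%R.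
Proof.
move=> jl ln; have ltn : level j < n.+1 by [].
rewrite /weight (bigD1 (Ordinal ltn)) //= jl lerDl.
by apply: sumr_ge0 => k _; case: ifP => // _; rewrite invr_ge0 exprn_ge0.
Qed.

Lemma mu_le k : n0 <= k -> k <= n -> mu k <= mu n.
Proof.
by move=> nk; rewrite leq_eqVlt => /predU1P[->//|kn]; apply/ltnW/mu_lt.
Qed.

Lemma sum_weight : (\sum_(j < N) weight j <= n.+1%:R)%R.
Proof.
rewrite exchange_big /=; apply: (@le_trans _ _ (\sum_(k < n.+1) 1)%R); last first.
  by rewrite sumr_const card_ord.
apply: ler_sum => k _; rewrite -big_mkcond /=.
have [nk|nk] := leqP n0 k; last first.
  by rewrite big_pred0 // => j; rewrite /in_level leqNgt nk.
rewrite sumr_const.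
have mk : mu k <= mu n by apply: mu_le; rewrite // -ltnS.
rewrite (card_in_level nk mk).
rewrite -[X in (X <= _)%R]mulr_natl natrX ler_pdivrMr ?exprn_gt0 // mul1r.
rewrite -!natrX ler_nat.
by rewrite leq_exp2l // (lamE nk) leq_addr.
Qed.

Lemma prod_weight u : all (fun j => in_level (level j) j && (level j <= n)) u ->
  (2 ^- (\sum_(j <- u) lam (level j)) <= \prod_(j <- u) weight j)%R.
Proof.
elim: u => [|j u IH] /=; first by rewrite !big_nil expr0 invr1.
case/andP=> /andP[jl jn] au; rewrite !big_cons exprD invfM.
by rewrite ler_pM ?invr_ge0 ?exprn_ge0 ?weight_ge ?IH.
Qed.

Definition light (u : seq nat) :=
  2 * (\sum_(j <- u) lam (level j)) <= n ^ 2 + lam n.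

(** Summing the product of the weights of both words over all pairs gives at most
    [n.+1 ^ (2 * l)], and each light pair contributes at least
    [2 ^- (n ^ 2 + lam n)]. *)
Lemma count_light l :
  \sum_(u : {ffun 'I_l -> 'I_N}) \sum_(v : {ffun 'I_l -> 'I_N})
    (rival n (word u) (word v) && light (word u) : nat)
  <= 2 ^ (n ^ 2 + lam n) * n.+1 ^ (2 * l).
Proof.
pose W := (\sum_(j < N) weight j)%R.
have WE : (W ^+ l = \sum_(u : {ffun 'I_l -> 'I_N}) \prod_(j <- word u) weight j)%R.
  rewrite -[l in LHS]card_ord -prodr_const bigA_distr_bigA /=.
  by apply: eq_bigr => u _; rewrite big_word.
have W0 : (0 <= W)%R by apply: sumr_ge0 => j _; apply: weight_ge0.
rewrite -(ler_nat R) natr_sum.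
apply: (@le_trans _ _ (2 ^+ (n ^ 2 + lam n) * (W ^+ l * W ^+ l))%R); last first.
  rewrite natrM !natrX ler_pM2l ?exprn_gt0 // -exprD addnn -mul2n.
  by apply: lerXn2r; rewrite ?nnegrE ?sum_weight.
rewrite {1}WE mulr_suml mulr_sumr; apply: ler_sum => u _.
rewrite WE natr_sum mulr_sumr mulr_sumr; apply: ler_sum => v _.
have w_ge0 s : (0 <= \prod_(j <- s) weight j)%R.
  by apply: prodr_ge0 => j _; apply: weight_ge0.
case: andP => [[riv li]|_]; last first.
  by rewrite mulr_ge0 ?exprn_ge0 ?mulr_ge0.
have /and5P[_] := riv; rewrite all_cat => /andP[au av] _ _ lev_uv.
have lev_sum : \sum_(j <- word u) lam (level j) = \sum_(j <- word v) lam (level j).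
  by rewrite -!(big_map level predT lam); apply: perm_big.
have pu := prod_weight au; have pv := prod_weight av; rewrite -lev_sum in pv.
set S := \sum_(j <- word u) lam (level j) in li pu pv.
rewrite -ler_pdivrMl ?exprn_gt0 // mulr1.
apply: (@le_trans _ _ (2 ^- S * 2 ^- S)%R).
  rewrite -invfM -exprD lef_pV2 ?posrE ?exprn_gt0 // ler_eXn2l ?ltr1n //.
  by rewrite addnn -mul2n.
by rewrite ler_pM ?invr_ge0 ?exprn_ge0.
Qed.

Definition bad (r : nat -> nat) j :=
  exists u v, [/\ rival n u v, collide r n u v & j \in u].

Definition bads r := [pred j : 'I_N | in_level n j && `[< bad r j >]].

(** By energy_le only light pairs can collide; the factor [h] bounds the number of
    elements that one pair spoils. *)
Lemma card_bads (f : {ffun 'I_K -> 'I_(2 ^ (2 * K))}) : f \in family (@window K) ->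
  #|bads (extend f)| <= \sum_(l < h.+1) \sum_(u : {ffun 'I_l -> 'I_N})
    \sum_(v : {ffun 'I_l -> 'I_N})
    h * ((rival n (word u) (word v) && light (word u)) *
         collide (extend f) n (word u) (word v)).
Proof.
move=> ff; pose B (l : 'I_h.+1) (u v : {ffun 'I_l -> 'I_N}) :=
  rival n (word u) (word v) && light (word u) && collide (extend f) n (word u) (word v).
apply: (@leq_trans (\sum_(j < N) \sum_(l < h.+1) \sum_(u : {ffun 'I_l -> 'I_N})
    \sum_(v : {ffun 'I_l -> 'I_N}) B l u v * (val j \in word u))); last first.
  rewrite exchange_big; apply: leq_sum => l _.
  rewrite exchange_big; apply: leq_sum => u _.
  rewrite exchange_big; apply: leq_sum => v _ /=.
  rewrite -big_distrr /= mulnC mulnb -/(B l u v); apply: leq_mul => //.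
  by apply: leq_trans (sum_mem_ord _ _) _; rewrite size_word -ltnS.
rewrite -sum1_card big_mkcond /=; apply: leq_sum => j _.
case: ifP => //; rewrite inE => /andP[jn /asboolP[u [v [riv col ju]]]].
have /and5P[uh] := riv; rewrite all_cat => /andP[au av] hu uv lev_uv.
have N0 : 0 < N by rewrite expn_gt0.
have small w : all (fun j => in_level (level j) j && (level j <= n)) w ->
    all (fun x => x < N) w.
  apply: sub_all => k /andP[/andP[nk /andP[_ kl]] kn].
  by apply: leq_trans kl _; rewrite leq_exp2l // ltnS mu_le.
have uh' : size u < h.+1 by [].
have vu : size v = size u by rewrite -(size_map level) -(perm_size lev_uv) size_map.
have [fu Eu] := @word_ex (Ordinal uh') N u erefl (small _ au) N0.
have [fv Ev] := @word_ex (Ordinal uh') N v vu (small _ av) N0.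
have li : light u := energy_le (admissible_extend ff) riv col.
rewrite (bigD1 (Ordinal uh')) //= (bigD1 fu) //= (bigD1 fv) //=.
by rewrite /B Eu Ev riv li col ju.
Qed.

(** The average number of spoiled elements of level [n] is at most
    [2 ^ - (n + 2)] times the size of the level. *)
Lemma sum_bads :
  (\sum_(f in family (@window K)) #|bads (extend f)|) * 2 ^ (n + 2) <=
  2 ^ mu n * #|family (@window K)|.
Proof.
set F := family (@window K); set A := \sum_(f in F) _.
have A_le : A * 2 ^ (n ^ 2 + n * slack n) <=
    h * h.+1 * n.+1 ^ (2 * h) * 2 ^ (n ^ 2 + lam n) * #|F|.
  apply: (@leq_trans (\sum_(l < h.+1) \sum_(u : {ffun 'I_l -> 'I_N})
    \sum_(v : {ffun 'I_l -> 'I_N})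
    h * (rival n (word u) (word v) && light (word u)) * #|F|)); last first.
    apply: (@leq_trans (\sum_(l < h.+1) h * n.+1 ^ (2 * h) * 2 ^ (n ^ 2 + lam n) * #|F|)).
      apply: leq_sum => l _.
      under eq_bigr => u _ do rewrite -big_distrl -big_distrr /=.
      rewrite -big_distrl -big_distrr /= -!mulnA leq_mul2l; apply/orP; right.
      rewrite mulnA leq_mul2r; apply/orP; right; apply: leq_trans (count_light l) _.
      by rewrite mulnC leq_mul2r leq_pexp2l ?orbT // leq_mul2l /= -ltnS.
    by rewrite sum_nat_const card_ord; lia.
  apply: (@leq_trans ((\sum_(l < h.+1) \sum_(u : {ffun 'I_l -> 'I_N})
    \sum_(v : {ffun 'I_l -> 'I_N}) \sum_(f in F)
    h * ((rival n (word u) (word v) && light (word u)) *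
         collide (extend f) n (word u) (word v))) * 2 ^ (n ^ 2 + n * slack n))).
    rewrite leq_mul2r; apply/orP; right.
    apply: (leq_trans (n := \sum_(f in F) _)).
      by apply: leq_sum => f; apply: card_bads.
    rewrite exchange_big; apply: leq_sum => l _.
    rewrite exchange_big; apply: leq_sum => u _.
    by rewrite exchange_big.
  rewrite big_distrl /=; apply: leq_sum => l _.
  rewrite big_distrl /=; apply: leq_sum => u _.
  rewrite big_distrl /=; apply: leq_sum => v _.
  rewrite -!big_distrr /= -!mulnA leq_mul2l; apply/orP; right.
  case: (boolP (rival _ _ _)) => [riv|_] //=; case: (light _) => //.
  rewrite !mul1n; apply: leq_trans (count_collide riv).
  rewrite leq_mul2r; apply/orP; right.
  rewrite -sum1_card [X in _ <= X]big_mkcond /= big_mkcond /=.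
  apply: leq_sum => f _; rewrite [X in _ <= (if X then _ else _)]inE.
  by case: ifP => //= _; case: collide.
have budget := slack_budget n0n.
have p2 a : 0 < 2 ^ a by rewrite expn_gt0.
rewrite -(leq_pmul2r (p2 (n ^ 2 + n * slack n))).
have -> : A * 2 ^ (n + 2) * 2 ^ (n ^ 2 + n * slack n) =
   A * 2 ^ (n ^ 2 + n * slack n) * 2 ^ (n + 2) by lia.
apply: (@leq_trans (h * h.+1 * n.+1 ^ (2 * h) * 2 ^ (n ^ 2 + lam n) * #|F| * 2 ^ (n + 2))).
  by rewrite leq_mul2r A_le orbT.
have -> : h * h.+1 * n.+1 ^ (2 * h) * 2 ^ (n ^ 2 + lam n) * #|F| * 2 ^ (n + 2) =
   h * h.+1 * n.+1 ^ (2 * h) * 2 ^ (lam n + (n + 2)) * (2 ^ n ^ 2 * #|F|).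
  by rewrite !expnD; lia.
have -> : 2 ^ mu n * #|F| * 2 ^ (n ^ 2 + n * slack n) =
   2 ^ (mu n + n * slack n) * (2 ^ n ^ 2 * #|F|) by rewrite !expnD; lia.
by rewrite leq_mul2r budget orbT.
Qed.

End Count.
(** By Markov's inequality the choices that spoil more than half of level [n] have
    density at most [2 ^- n.+1], and these densities sum to less than one. *)
Lemma exists_few_bads n1 : exists r, admissible r /\
  forall n, n <= n1 -> n0 <= n -> 2 * #|bads n r| <= 2 ^ mu n.
Proof.
pose K := ndigits n1; pose F := family (@window K).
pose viol (f : {ffun 'I_K -> 'I_(2 ^ (2 * K))}) n :=
  (n0 <= n) && (2 ^ mu n < 2 * #|bads n (extend f)|).
pose V n := \sum_(f in F) viol f n.
have V_le n : n <= n1 -> V n * 2 ^ n.+1 <= #|F|.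
  move=> nn; have lenK : ndigits n <= K by apply: leq_ndigits.
  have [n0n|nn0] := leqP n0 n; last first.
    by rewrite /V big1 // => f _; rewrite /viol leqNgt nn0.
  have := sum_bads lenK n0n; rewrite -/F => budget.
  have p2 : 0 < 2 ^ mu n by rewrite expn_gt0.
  rewrite -(leq_pmul2l p2); apply: leq_trans budget.
  have -> : 2 ^ mu n * (V n * 2 ^ n.+1) = (2 ^ mu n * V n) * 2 ^ n.+1 by lia.
  have -> : 2 ^ (n + 2) = 2 * 2 ^ n.+1 by rewrite -expnS; congr (2 ^ _); lia.
  rewrite mulnA leq_mul2r; apply/orP; right.
  rewrite big_distrr big_distrl /=; apply: leq_sum => f _.
  by rewrite /viol n0n /=; case: ltnP; lia.
(* The total over [n < m] is at most [1 - 2 ^- m] of all choices. *)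
have sumV m : m <= n1.+1 -> (\sum_(n < m) V n) * 2 ^ m + #|F| <= #|F| * 2 ^ m.
  elim: m => [|m IH] mn; first by rewrite big_ord0 mul0n muln1.
  have := IH (ltnW mn); have := V_le m mn; rewrite big_ord_recr /= !expnS.
  set S := \sum_(_ < _) _; nia.
have F0 : 0 < #|F| := family_window_gt0 K.
have [/existsP[f /andP[fF /forallP ok]]|none] :=
  boolP [exists f, (f \in F) && [forall n : 'I_n1.+1, ~~ viol f n]].
  exists (extend f); split=> [|n nn n0n]; first exact: admissible_extend.
  have nn' : n < n1.+1 by [].
  by have := ok (Ordinal nn'); rewrite /viol /= n0n /= -leqNgt.
have : #|F| <= \sum_(n < n1.+1) V n.
  rewrite exchange_big /= -sum1_card; apply: leq_sum => f fF.
  move: none; rewrite negb_exists => /forallP/(_ f); rewrite fF /= negb_forall.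
  by case/existsP => n; rewrite negbK => vn; rewrite (bigD1 n) //= vn.
have := sumV n1.+1 (leqnn _); have : 0 < 2 ^ n1.+1 by rewrite expn_gt0.
by nia.
Qed.

(** Whether an element of level [n] is spoiled depends only on the first
    [ndigits n] moduli. *)
Lemma leq_bads n r r' : (forall i, i < ndigits n -> r i = r' i) ->
  #|bads n r| <= #|bads n r'|.
Proof.
move=> e; apply/subset_leq_card/fintype.subsetP => j; rewrite !inE => /andP[-> /=].
move=> /asboolP[u [v [riv col ju]]]; apply/asboolP; exists u, v; split=> //.
apply/allP => i il; have := allP col i il; rewrite e //.
by move: il; rewrite mem_iota.
Qed.

Lemma good_moduli : exists r, admissible r /\
  forall n, n0 <= n -> 2 * #|bads n r| <= 2 ^ mu n.
Proof.
apply: (@compactness _ _ ndigits (fun n r => n0 <= n -> 2 * #|bads n r| <= 2 ^ mu n)).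
  move=> n r r' e H nn; apply: leq_trans (H nn).
  by rewrite leq_mul2l leq_bads // => i /e.
by move=> n1; have [r [ar H]] := exists_few_bads n1; exists r.
Qed.

(** * The sequence *)

Section Sequence.

Variables (r : nat -> nat) (ind : nat -> nat -> nat).
Hypothesis ar : admissible r.
Hypothesis few : forall n, n0 <= n -> 2 * #|bads n r| <= 2 ^ mu n.
Hypothesis ind_lt : forall p a, prime p -> ind p a < p.
Hypothesis ind_prod : forall p (s t : seq nat), prime p ->
  all (coprime p) s -> all (coprime p) t ->
  \sum_(a <- s) ind p a = \sum_(a <- t) ind p a ->
  \prod_(a <- s) a = \prod_(a <- t) a %[mod p].

Definition modulus i := nth_prime (r i).
Definition bh_elt j := code h modulus ind nth_prime (fun j => ndigits (level j)) j.
Definition good j := in_level (level j) j /\ ~ bad (level j) r j.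

Lemma h_gt0 : 0 < h. Proof. exact: ltnW. Qed.

Lemma modulus_gt0 i : 0 < modulus i.
Proof. by rewrite prime_gt0 ?nth_prime_prime. Qed.

Lemma ind_modulus_lt i j : ind (modulus i) (nth_prime j) < modulus i.
Proof. exact/ind_lt/nth_prime_prime. Qed.

(** The indices of the moduli used at a level are smaller than those of the primes
    of that level. *)
Lemma coprime_modulus i j : in_level (level j) j -> i < ndigits (level j) ->
  coprime (modulus i) (nth_prime j).
Proof.
move=> jl il; rewrite prime_coprime ?nth_prime_prime // dvdn_prime2 ?nth_prime_prime //.
apply/eqP => /nth_prime_inj e; have /andP[_] := ar i; rewrite e.
have /andP[nj /andP[+ _]] := jl; have := ndigits_mu nj.
move=> lm mj jr; have := leq_ltn_trans mj jr.
by rewrite ltn_exp2l //; lia.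
Qed.

(** If the multisets differ, cancelling the common elements leaves a colliding
    pair of rivals, and this pair spoils its element of top level. *)
Lemma bh_elt_sum_inj (s t : seq nat) : size s <= h -> size t <= h ->
  {in s, forall j, good j} -> {in t, forall j, good j} ->
  \sum_(j <- s) bh_elt j = \sum_(j <- t) bh_elt j -> perm_eq s t.
Proof.
move=> sh th gs gt; have [u [v [w [su tv uv]]]] := perm_cancel s t.
rewrite (perm_big _ su) (perm_big _ tv) !big_cat /= => /addIn E.
have gu : {in u, forall j, good j}.
  by move=> j ju; apply: gs; rewrite (perm_mem su) mem_cat ju.
have gv : {in v, forall j, good j}.
  by move=> j jv; apply: gt; rewrite (perm_mem tv) mem_cat jv.
have uh : size u <= h.
  by apply: leq_trans sh; rewrite (perm_size su) size_cat leq_addr.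
have vh : size v <= h.
  by apply: leq_trans th; rewrite (perm_size tv) size_cat leq_addr.
have H := code_sum_inj h_gt0 modulus_gt0 ind_modulus_lt uh vh E.
have lev_uv := perm_levels ndigits_mono ndigits_gt0 (fun i => (H i).1).
have u0 : u = [::] -> perm_eq s t.
  move=> u0; have v0 : v = [::].
    by apply/nilP; rewrite /nilp -(size_map level) -(perm_size lev_uv) u0.
  by apply: perm_trans su _; rewrite perm_sym u0 -v0.
case Eu: u => [|j1 u1]; first exact: u0.
have ex : exists x, x \in [seq level j | j <- u].
  by exists (level j1); rewrite Eu map_f // mem_head.
have bnd x : x \in [seq level j | j <- u] -> x <= \sum_(j <- u) level j.
  by case/mapP => j ju ->; rewrite (big_rem j ju) leq_addr.
case: (ex_maxnP ex bnd) => n /mapP[j0 ju En] n_max.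
have [_ []] := gu _ ju; rewrite -En; exists u, v; split=> //.
  apply/and5P; split=> //.
    rewrite all_cat; apply/andP; split; apply/allP => j jw.
      by have [-> _] := gu _ jw; apply: n_max; rewrite map_f.
    by have [-> _] := gv _ jw; apply: n_max; rewrite (perm_mem lev_uv) map_f.
  by apply/hasP; exists j0 => //; rewrite En.
apply/allP => i; rewrite mem_iota add0n => /andP[_ il].
have [_ Hi] := H i; rewrite dvd_absdiff /active; apply/eqP.
have red x : \prod_(j <- x | i < ndigits (level j)) nth_prime j =
    \prod_(a <- [seq nth_prime j | j <- x & i < ndigits (level j)]) a.
  by rewrite big_map big_filter.
have cop x : {in x, forall j, good j} ->
    all (coprime (modulus i)) [seq nth_prime j | j <- x & i < ndigits (level j)].
  move=> gx; apply/allP => _ /mapP[j + ->]; rewrite mem_filter => /andP[ij jx].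
  by apply: coprime_modulus ij; have [] := gx _ jx.
rewrite !red; apply: ind_prod; rewrite ?nth_prime_prime ?cop //.
by rewrite !big_map !big_filter.
Qed.

Lemma bh_elt_inj j k : good j -> good k -> bh_elt j = bh_elt k -> j = k.
Proof.
move=> gj gk e; have : perm_eq [:: j] [:: k].
  apply: bh_elt_sum_inj; rewrite ?h_gt0 ?big_seq1 //.
    by move=> x; rewrite inE => /eqP->.
  by move=> x; rewrite inE => /eqP->.
by move/perm_mem => /(_ j); rewrite !inE eqxx => /esym/eqP.
Qed.

Lemma bh_elt_ge n j : in_level n j -> 2 ^ (n ^ 2) <= bh_elt j.
Proof.
move=> jn; have Ej := levelE jn.
apply: leq_trans (code_ge _ _ h_gt0 modulus_gt0 _); last first.
  by rewrite Ej; apply: leq_trans ndigits_gt0 (leq_ndigits _).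
rewrite Ej; apply: (leq_trans (n := 2 ^ (ndigits n ^ 2))).
  by rewrite leq_exp2l // leq_exp2r // leq_addr.
rewrite -prod_odd_powers; apply: leq_prod => i _.
by apply: leq_trans (ltnW (nth_prime_gt _)); case/andP: (ar i).
Qed.

Definition height n := ndigits n ^ 2 + ndigits n * (2 * bitlen n + 3 * h + 9).

Lemma modulus_le n i : 0 < n -> i < ndigits n ->
  modulus i <= 2 ^ ((2 * i).+2 + (2 * bitlen n + h + 8)).
Proof.
move=> n_gt0 il; apply: nth_prime_le; [lia | | by case/andP: (ar i)].
have hh : h < 2 ^ h by apply: ltn_expl.
have nl := ltn_bitlen n; have ln := bitlen_leq n_gt0.
have i_le : i.+1 <= (4 * h + 8) * n.
  by apply: leq_trans il _; rewrite /ndigits /slack; nia.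
have e1 : 2 ^ (2 * bitlen n) = 2 ^ bitlen n * 2 ^ bitlen n.
  by rewrite -expnD addnn mul2n.
rewrite !expnD e1.
set A := 2 ^ bitlen n in nl *; set B := 2 ^ h in hh *.
have b1 : A <= A * A by rewrite leq_pmulr; lia.
have b2 : A * B <= A * A * B by rewrite leq_mul2r b1 orbT.
have b3 : (h.+1) * n <= A * B by rewrite mulnC leq_mul // ltnW.
have -> : 2 ^ 8 = 256 by [].
nia.
Qed.

Lemma bh_elt_lt n j : in_level n j -> bh_elt j < 2 ^ height n.
Proof.
move=> jn; have Ej := levelE jn; have n0n : n0 <= n by case/andP: jn.
have n_gt0 : 0 < n by apply: leq_trans n0_gt0 n0n.
have lt := @code_lt h modulus ind nth_prime (fun j => ndigits (level j)) h_gt0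
  modulus_gt0 ind_modulus_lt j.
rewrite Ej in lt; apply: leq_trans lt _.
apply: (leq_trans (n := \prod_(i < ndigits n)
    (2 ^ (2 * i).+1 * 2 ^ (2 * bitlen n + 3 * h + 9)))).
  apply: leq_prod => i _; rewrite /radix.
  apply: (leq_trans (n := 2 ^ (2 * h) * 2 ^ ((2 * i).+2 + (2 * bitlen n + h + 8)))).
    apply: leq_mul; last exact: modulus_le.
    rewrite mul2n -addnn expnD; apply: leq_mul; last exact: ltn_expl.
    exact/ltnW/ltn_expl.
  by rewrite -!expnD leq_exp2l //; lia.
rewrite big_split /= prod_odd_powers prod_nat_const card_ord -expnM -expnD.
by rewrite leq_exp2l // /height [X in _ + X]mulnC.
Qed.

Definition level_goods n :=
  [pred j : 'I_(2 ^ (mu n).+1) | in_level n j && ~~ `[< bad n r j >]].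

Lemma level_goodsP n j : j \in level_goods n -> good j /\ in_level n j.
Proof.
by rewrite inE => /andP[jn /asboolPn nb]; split=> //; rewrite /good (levelE jn).
Qed.

Lemma card_level_goods n : n0 <= n -> 2 ^ mu n <= 2 * #|level_goods n|.
Proof.
move=> nn; have := few nn; have := card_in_level nn (leqnn _).
have : #|[pred j : 'I_(2 ^ (mu n).+1) | in_level n j]| = #|bads n r| + #|level_goods n|.
  rewrite -(cardID [pred j : 'I_(2 ^ (mu n).+1) | `[< bad n r j >]]).
  by congr (_ + _); apply: eq_card => j; rewrite !inE // andbC.
lia.
Qed.

End Sequence.

Lemma discrete_logs : exists ind : nat -> nat -> nat,
  (forall p a, prime p -> ind p a < p) /\
  (forall p (s t : seq nat), prime p ->
    all (coprime p) s -> all (coprime p) t ->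
    \sum_(a <- s) ind p a = \sum_(a <- t) ind p a ->
    \prod_(a <- s) a = \prod_(a <- t) a %[mod p]).
Proof.
have /choice[ind H] : forall p, exists f : nat -> nat, prime p ->
    (forall a, f a < p) /\
    (forall s t : seq nat, all (coprime p) s -> all (coprime p) t ->
     \sum_(a <- s) f a = \sum_(a <- t) f a ->
     \prod_(a <- s) a = \prod_(a <- t) a %[mod p]).
  move=> p; have [pp|npp] := boolP (prime p); last by exists id.
  by have [f [f1 f2]] := discrete_log pp; exists f.
exists ind; split=> [p a /H[]//|p s t /H[_]]; exact.
Qed.

(** The growth of the sequence is recorded level by level: the elements below
    [2 ^ (n.+1 ^ 2)] have level at most [n], and at least half of level [n]
    survives. *)
Lemma graded_Bh_sequence_exists : exists B : set nat,
  [/\ Bh_sequence h B,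
      forall n, n0 <= n -> exists s : seq nat, size s <= 2 ^ lam n /\
        forall b, B b -> b < 2 ^ (n.+1 ^ 2) -> b \in s
    & forall n, n0 <= n -> exists s : seq nat,
        [/\ uniq s, 2 ^ mu n <= 2 * size s &
            forall b, b \in s -> B b /\ b < 2 ^ height n]].
Proof.
have [r [ar few]] := good_moduli; have [ind [ind_lt ind_prod]] := discrete_logs.
pose e := bh_elt r ind; pose B : set nat := [set e j | j in good r]%classic.
have /choice[g gP] : forall b, exists j, B b -> good r j /\ e j = b.
  move=> b; have [[j gj jb]|nB] := EM (B b); last by exists 0.
  by exists j.
exists B; split.
- split.
    move=> _ [j [jl _] <-]; apply: leq_trans (bh_elt_ge ind ar jl).
    by rewrite expn_gt0.
  move=> b b'; rewrite !inE => -[sb Bb] [sb' Bb'] E.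
  have sumE (t : h.-tuple nat) : (forall i, B (tnth t i)) ->
      \sum_(j <- map g t) e j = \sum_(i < h) tnth t i.
    move=> Bt; rewrite big_map big_tuple; apply: eq_bigr => i _.
    by have [] := gP _ (Bt i).
  have tB (t : h.-tuple nat) : (forall i, B (tnth t i)) -> forall x, x \in t -> B x.
    by move=> Bt x /tnthP[i ->].
  have goodE (t : h.-tuple nat) : (forall i, B (tnth t i)) ->
      {in map g t, forall j, good r j}.
    by move=> Bt _ /mapP[x /(tB _ Bt)/gP[gx _] ->].
  have mapE (t : h.-tuple nat) : (forall i, B (tnth t i)) -> map e (map g t) = t.
    move=> Bt; rewrite -map_comp -[RHS]map_id; apply/eq_in_map => x xt.
    by have [] := gP _ (tB _ Bt _ xt).
  have pm : perm_eq (map g b) (map g b').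
    apply: (bh_elt_sum_inj ar ind_lt ind_prod); rewrite ?size_map ?size_tuple //.
    - exact: goodE.
    - exact: goodE.
    - by rewrite !sumE.
  apply/val_inj/(sorted_eq leq_trans anti_leq) => //.
  by have := perm_map e pm; rewrite !mapE.
- move=> n nn; exists [seq e j | j <- iota 0 (2 ^ (mu n).+1)]; split.
    by rewrite size_map size_iota leq_exp2l // (lamE nn); lia.
  move=> _ [j [jl nb] <-] lt; apply: map_f; rewrite mem_iota add0n /=.
  have jn : level j <= n.
    have := leq_ltn_trans (bh_elt_ge ind ar jl) lt.
    by rewrite ltn_exp2l // ltn_exp2r.
  have /andP[nj /andP[_ jlt]] := jl; apply: leq_trans jlt _.
  by rewrite leq_exp2l // ltnS mu_le.
- move=> n nn; exists [seq e (val j) | j <- enum (level_goods r n)]; split.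
  + rewrite map_inj_in_uniq ?enum_uniq // => j k; rewrite !mem_enum.
    move=> /level_goodsP[gj _] /level_goodsP[gk _] E; apply: val_inj.
    exact: (bh_elt_inj ar ind_lt ind_prod gj gk E).
  + by rewrite size_map -cardE card_level_goods.
  + move=> _ /mapP[j + ->]; rewrite mem_enum => /level_goodsP[gj jn]; split.
      by exists (val j).
    exact: bh_elt_lt.
Qed.

End Construction.

(** * The counting function *)

Lemma sqr_le_4exp2 k : k.+1 ^ 2 <= 4 * 2 ^ k.
Proof.
case: k => [|[|k]] //; elim: k => [|k IH] //.
rewrite -!mulnn in IH *; rewrite [2 ^ k.+3]expnS; nia.
Qed.

Lemma mul_bitlen_le A : exists M, forall m, M <= m -> A * bitlen m <= m.
Proof.
exists (2 ^ (4 * A)) => m Mm.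
have m0 : 0 < m by apply: leq_trans Mm; rewrite expn_gt0.
have jA : 4 * A <= bitlen m by apply: leqW; apply: trunc_log_max.
have km : 2 ^ (trunc_log 2 m) <= m by apply: trunc_logP.
have := sqr_le_4exp2 (trunc_log 2 m); rewrite -/(bitlen m) => j2.
have : 4 * A * bitlen m <= bitlen m ^ 2 by rewrite expnS expn1 leq_mul2r jA orbT.
lia.
Qed.

Lemma height_le h : exists D, forall n, 0 < n ->
  height h n <= n ^ 2 + D * n * bitlen n.
Proof.
pose C := 4 * h + 7; exists (2 * C + C * C + C.+1 * (3 * h + 11)) => n n0.
rewrite /height /ndigits /slack -/C; have ln := bitlen_leq n0.
have l0 : 0 < bitlen n by [].
set l := bitlen n in ln l0 *.
have e1 : (n + C * l) ^ 2 <= n ^ 2 + (2 * C + C * C) * n * l by nia.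
have e2 : n + C * l <= C.+1 * n by nia.
have e3 : 2 * l + 3 * h + 9 <= (3 * h + 11) * l by nia.
by apply: leq_trans (leq_add e1 (leq_mul e2 e3)) _; lia.
Qed.

Section Counting.

Variables (R : realType) (B : set nat).

Lemma finite_initial (x : R) :
  finite_set (B `&` [set n : nat | (1 : R) <= n%:R <= x]%R)%classic.
Proof.
apply: (@sub_finite_set _ _ `I_(Num.truncn x).+1); last exact: finite_II.
move=> n [_ /andP[_ nx]] /=; rewrite ltnS.
rewrite truncn_ge_nat //; apply: le_trans nx; exact: ler0n.
Qed.

Lemma counting_le (x : R) (s : seq nat) :
  (forall b, B b -> (b%:R <= x)%R -> b \in s) -> counting_function B x <= size s.
Proof.
move=> H; apply: uniq_leq_size; first exact: fset_uniq.
move=> b; rewrite in_fset_set ?inE => [[Bb /andP[_ bx]]|]; first exact: H.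
exact: finite_initial.
Qed.

Lemma counting_ge (x : R) (s : seq nat) : uniq s ->
  (forall b, b \in s -> [/\ B b, 0 < b & (b%:R <= x)%R]) ->
  size s <= counting_function B x.
Proof.
move=> us H; apply: uniq_leq_size => // b /H[Bb b0 bx].
rewrite in_fset_set; last exact: finite_initial.
by rewrite inE; split=> //=; rewrite bx (ler_nat R 1) b0.
Qed.

End Counting.

(** The exponent of [f x] is [ln (f x) / ln x]; a two-sided estimate by powers
    says that it stays within [e] of [c]. *)
Lemma eq_powR_o1_squeeze (R : realType) (f : R -> R) (c : R) :
  (forall e : R, (0 < e)%R -> exists M : R, forall x : R, (M <= x)%R ->
     (x `^ (c - e) <= f x <= x `^ (c + e))%R) ->
  eq_powR_o1 f c.
Proof.
move=> H; exists (fun x => ln (f x) / ln x - c)%R; split.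
  apply/cvgrPdist_le => e e0; have [M HM] := H e e0.
  near=> x.
  have xM : (M <= x)%R by near: x; apply: nbhs_pinfty_ge; rewrite num_real.
  have x1 : (1 < x)%R by near: x; apply: nbhs_pinfty_gt; rewrite num_real.
  have x0 : (0 < x)%R by apply: lt_trans x1.
  have lx : (0 < ln x)%R by rewrite ln_gt0.
  have /andP[fl fu] := HM x xM.
  have fp : (0 < f x)%R by apply: lt_le_trans fl; apply: powR_gt0.
  rewrite sub0r normrN ler_norml.
  have l1 : ((c - e) * ln x <= ln (f x))%R.
    by rewrite -ln_powR ler_ln ?posrE ?powR_gt0.
  have l2 : (ln (f x) <= (c + e) * ln x)%R.
    by rewrite -ln_powR ler_ln ?posrE ?powR_gt0.
  rewrite -ler_pdivlMr // in l1; rewrite -ler_pdivrMr // in l2.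
  by apply/andP; split; lra.
have [M HM] := H 1%R ltr01.
near=> x.
have xM : (M <= x)%R by near: x; apply: nbhs_pinfty_ge; rewrite num_real.
have x1 : (1 < x)%R by near: x; apply: nbhs_pinfty_gt; rewrite num_real.
have x0 : (0 < x)%R by apply: lt_trans x1.
have lx : (0 < ln x)%R by rewrite ln_gt0.
have /andP[fl fu] := HM x xM.
have fp : (0 < f x)%R by apply: lt_le_trans fl; apply: powR_gt0.
rewrite addrC subrK; apply: ln_inj; rewrite ?posrE ?powR_gt0 //.
by rewrite ln_powR divfK // gt_eqF.
Unshelve. all: by end_near.
Qed.

Lemma scale_between (R : realType) (g : nat -> nat) (x : R) m :
  (forall n, n <= g n) -> ((2 ^ g m)%:R <= x)%R ->
  exists n, [/\ m <= n, ((2 ^ g n)%:R <= x)%R & (x < (2 ^ g n.+1)%:R)%R].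
Proof.
move=> gn gm; pose P n := ((2 ^ g n)%:R <= x)%R.
have bnd n : P n -> n <= Num.truncn x.
  move=> Pn; rewrite truncn_ge_nat; last by apply: le_trans Pn; apply: ler0n.
  apply: le_trans Pn; rewrite ler_nat; apply: leq_trans (gn n) _.
  exact/ltnW/ltn_expl.
case: (ex_maxnP (ex_intro P m gm) bnd) => n Pn n_max; exists n; split=> //.
  exact: n_max.
by rewrite ltNge; apply/negP => /n_max; rewrite ltnn.
Qed.

(** The largest [n] with [2 ^ (n ^ 2) <= x] gives the upper bound [x `^ c], and the
    largest [n] with [2 ^ height n <= x] the lower bound. *)
Lemma growth_counting (R : realType) (c : R) h n0 (B : set nat) :
  (0 < c)%R -> (c <= 1)%R ->
  (((2 * (4 * h + 7) + 7)%:R : R) <= c * n0%:R)%R ->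
  (forall b, B b -> 0 < b) ->
  (forall n, n0 <= n -> exists s : seq nat, size s <= 2 ^ lam c n /\
     forall b, B b -> b < 2 ^ (n.+1 ^ 2) -> b \in s) ->
  (forall n, n0 <= n -> exists s : seq nat,
     [/\ uniq s, 2 ^ mu c n <= 2 * size s &
         forall b, b \in s -> B b /\ b < 2 ^ height h n]) ->
  eq_powR_o1 (fun x : R => (counting_function B x)%:R)%R c.
Proof.
move=> c_gt0 c_le1 n0_large B_gt0 upper lower.
apply: eq_powR_o1_squeeze => e e0.
(* The monotonicity of powers in the base needs the exponent [c - e'] to be
   nonnegative. *)
pose e' := Num.min e c.
have e'0 : (0 < e')%R by rewrite lt_min e0.
have e'e : (e' <= e)%R by rewrite ge_min lexx.
have ce' : (0 <= c - e')%R by rewrite subr_ge0 ge_min lexx orbT.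
have [D HD] := height_le h.
pose A := (Num.truncn ((D + 8)%:R / e')%R).+1.
have DA : ((D + 8)%:R <= A%:R * e' :> R)%R.
  by rewrite -ler_pdivrMr //; apply/ltW/truncnS_gt.
have [M HM] := mul_bitlen_le A.
pose N := maxn n0 M.
have n_height n : n ^ 2 <= height h n.
  by apply: leq_trans (leq_addr _ _); rewrite leq_exp2r // leq_addr.
have n_sqr n : n <= n ^ 2 by rewrite expnS expn1; nia.
exists ((2 ^ height h N)%:R)%R => x xN.
have x1 : (1 <= x)%R.
  by apply: le_trans xN; rewrite (ler_nat R 1) expn_gt0.
have x0 : (0 <= x)%R by apply: le_trans x1.
have pow2 k : ((2 ^ k)%:R = 2 `^ k%:R :> R)%R by rewrite powR_mulrn ?ler0n // natrX.
apply/andP; split.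
  have hgt n : n <= height h n by apply: leq_trans (n_sqr n) (n_height n).
  have [n [Nn xn xn1]] := scale_between hgt xN.
  have n0n : n0 <= n by apply: leq_trans Nn; rewrite leq_maxl.
  have [s [us ms sB]] := lower n n0n.
  have s_le : size s <= counting_function B x.
    apply: counting_ge => // b /sB[Bb b_lt]; split=> //; first exact: B_gt0.
    by apply: le_trans xn; rewrite ler_nat ltnW.
  apply: (@le_trans _ _ ((size s)%:R)%R); last by rewrite ler_nat.
  apply: (@le_trans _ _ (x `^ (c - e'))%R).
    by rewrite ler_powR // lerD2l lerN2.
  apply: (@le_trans _ _ ((2 `^ (height h n.+1)%:R) `^ (c - e'))%R).
    apply: ge0_ler_powR => //; rewrite ?nnegrE ?powR_ge0 //.
    by rewrite -pow2 ltW.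
  rewrite -powRrM -(@ler_pM2l _ 2%R) //.
  apply: (@le_trans _ _ ((2 ^ mu c n)%:R)%R); last by rewrite -natrM ler_nat.
  rewrite pow2 -{1}[2%R]powRr1 // -powRD; last by rewrite pnatr_eq0 implybT.
  rewrite ler_powR //; first by lra.
  (* [height n.+1] exceeds [n.+1 ^ 2] by at most [D * n.+1 * bitlen n.+1]; the gain
     [e' * n.+1 ^ 2] absorbs this, the deficit of [mu] and the step from [n] to
     [n.+1]. *)
  have m_le : (A%:R * (bitlen n.+1)%:R <= n%:R + 1 :> R)%R.
    rewrite natr1 -natrM ler_nat; apply: HM.
    by apply: leq_trans (leqW Nn); rewrite leq_maxr.
  have Hh : ((height h n.+1)%:R <=
      (n%:R + 1) ^+ 2 + D%:R * (n%:R + 1) * (bitlen n.+1)%:R :> R)%R.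
    by rewrite natr1 -natrX -!natrM -natrD ler_nat; apply: HD.
  have mu_gt : (c * n%:R ^+ 2 < (mu c n)%:R + (2 * (bitlen n)%:R + 2) + 1)%R.
    apply: lt_le_trans (lam_gt c n) _.
    by rewrite (lamE c_gt0 c_le1 n0_large n0n) -natr1 !natrD natrM.
  have el : ((bitlen n)%:R <= (bitlen n.+1)%:R :> R)%R by rewrite ler_nat leq_bitlen.
  have l1 : (1 <= (bitlen n.+1)%:R :> R)%R by rewrite (ler_nat R 1).
  have y0 : (0 <= n%:R :> R)%R by rewrite ler0n.
  have d0 : (0 <= D%:R :> R)%R by rewrite ler0n.
  rewrite natrD in DA; move: m_le Hh mu_gt el l1 y0 d0 DA.
  set H := ((height h n.+1)%:R)%R; set l := ((bitlen n.+1)%:R)%R.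
  set l' := ((bitlen n)%:R)%R; set y := (n%:R)%R; set d := (D%:R)%R; set a := (A%:R)%R.
  set mm := ((mu c n)%:R)%R.
  move=> al hH muc ll l1 y0 d0 da.
  have s1 : ((d + 8) * l <= e' * (y + 1))%R.
    apply: (@le_trans _ _ (a * e' * l)%R); first by rewrite ler_pM2r //; lra.
    have -> : (a * e' * l = e' * (a * l))%R by ring.
    by rewrite ler_pM2l.
  have s2 : ((c - e') * H <= (c - e') * ((y + 1) ^+ 2 + d * (y + 1) * l))%R.
    by rewrite ler_wpM2l.
  have s3 : ((d + 8) * l * (y + 1) <= e' * (y + 1) * (y + 1))%R.
    by rewrite ler_wpM2r //; lra.
  have s4 : (0 <= (1 - c + e') * (d * (y + 1) * l))%R.
    have l0 : (0 <= l)%R := le_trans ler01 l1.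
    apply: mulr_ge0; first by rewrite addr_ge0 ?subr_ge0 // ltW.
    by rewrite !mulr_ge0 ?addr_ge0.
  have s5 : (0 <= (l - 1) * (y + 1))%R by rewrite mulr_ge0 ?subr_ge0 ?addr_ge0.
  have s6 : (0 <= l * y)%R by rewrite mulr_ge0 //; lra.
  have s7 : (0 <= (1 - c) * y)%R by rewrite mulr_ge0 //; lra.
  rewrite expr2 in s2 muc; rewrite expr2 in muc.
  lra.
have xN2 : ((2 ^ (N ^ 2))%:R <= x)%R.
  by apply: le_trans xN; rewrite ler_nat leq_exp2l.
have [n [Nn xn xn1]] := scale_between n_sqr xN2.
have n0n : n0 <= n by apply: leq_trans Nn; rewrite leq_maxl.
have [s [s_le sB]] := upper n n0n.
apply: (@le_trans _ _ ((2 ^ lam c n)%:R)%R).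
  rewrite ler_nat; apply: leq_trans s_le; apply: counting_le => b Bb bx.
  by apply: sB => //; rewrite -(ltr_nat R); apply: le_lt_trans xn1.
rewrite pow2; apply: (@le_trans _ _ (2 `^ ((n ^ 2)%:R * c))%R).
  by rewrite ler_powR ?(ler_nat R 1) // natrX mulrC lam_le.
rewrite powRrM -pow2; apply: (@le_trans _ _ (x `^ c)%R).
  by apply: ge0_ler_powR => //; rewrite ?nnegrE ?ler0n // ltW.
by rewrite ler_powR // lerDl ltW.
Qed.

Lemma infinite_of_large_subsets (B : set nat) :
  (forall k, exists s : seq nat, [/\ uniq s, k <= size s & forall b, b \in s -> B b]) ->
  infinite_set B.
Proof.
move=> H /finite_seqP[t Et]; have [s [us ks sB]] := H (size t).+1.
have : size s <= size t.
  by apply: uniq_leq_size => // b /sB; rewrite Et.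
by rewrite leqNgt ks.
Qed.

Lemma dense_Bh_sequence_exists (R : realType) (h : nat) : 1 < h ->
  exists B : set nat,
    [/\ infinite_set B,
        Bh_sequence h B
      & eq_powR_o1 (fun x : R => (counting_function B x)%:R)%R
          (Num.sqrt ((h%:R - 1) ^+ 2 + 1) - (h%:R - 1))%R].
Proof.
move=> h_gt1; set c := (Num.sqrt _ - _)%R.
have h2 : (2 <= h%:R :> R)%R by rewrite (ler_nat R 2).
have k1 : (1 <= h%:R - 1 :> R)%R by lra.
have c_eq : (c ^+ 2 + 2 * (h%:R - 1) * c = 1)%R.
  have : (Num.sqrt ((h%:R - 1) ^+ 2 + 1) ^+ 2 = (h%:R - 1) ^+ 2 + 1 :> R)%R.
    by rewrite sqr_sqrtr // addr_ge0 // sqr_ge0.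
  rewrite /c; set q := Num.sqrt _; set k := (h%:R - 1)%R; rewrite !expr2; lra.
have c_gt0 : (0 < c)%R.
  rewrite /c subr_gt0 -[ltLHS]ger0_norm; last by lra.
  by rewrite -sqrtr_sqr ltr_sqrt; have := sqr_ge0 (h%:R - 1 : R)%R; lra.
have c_le1 : (c <= 1)%R by nra.
pose n0 := (Num.truncn ((2 * (4 * h + 7) + 7)%:R / c)%R).+1.
have n0_large : ((2 * (4 * h + 7) + 7)%:R <= c * n0%:R)%R.
  by rewrite -ler_pdivrMl // mulrC; apply/ltW/truncnS_gt.
have [B [BhB upper lower]] := graded_Bh_sequence_exists c_gt0 c_le1 n0_large c_eq h_gt1.
exists B; split=> //; last first.
  by apply: growth_counting n0_large _ upper lower => //; case: BhB.
apply: infinite_of_large_subsets => k.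
have nn : n0 <= n0 + k.+1 by apply: leq_addr.
have [s [us ms sB]] := lower _ nn; exists s; split=> //; last by move=> b /sB[].
have := ndigits_mu c_gt0 c_le1 n0_large nn; rewrite /ndigits => lm.
have : mu c (n0 + k.+1) < 2 ^ mu c (n0 + k.+1) by apply: ltn_expl.
lia.
Qed.

Local Open Scope classical_set_scope.
Local Open Scope ring_scope.

Theorem theorem1p1 (R : realType) (h : nat) (hh : h \in [:: 2; 3; 4]%N) :
  exists B : set nat,
    [/\ infinite_set B,
        Bh_sequence h B
      & eq_powR_o1 (fun x : R => (counting_function B x)%:R)
          (Num.sqrt ((h%:R - 1) ^+ 2 + 1) - (h%:R - 1))].
Proof.
apply: dense_Bh_sequence_exists.
by move: hh; rewrite !inE => /or3P[] /eqP ->.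
Qed.
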